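(* There exist, for all integers $A>8$, classes $\mathcal{C}(A)$ of (non-convex) polygons without obstacles, each polygon $\mathcal{P}\in\mathcal{C}(A)$ equipped with an initial agent position $p$ and a treasure position $q$, such that for each of them the length $L$ of a shortest path from $p$ to $q$ in $\mathcal{P}$ satisfies $L=\Theta(A)$ (indeed $A/2<L<5A/2$), the accessibility of the treasure is $\lambda=1$, and the smallest size of advice allowing treasure hunt at cost $O(L)$ in all polygons of $\mathcal{C}(A)$ is $\Omega(L)$. Precisely: for every constant $C>0$ there is $A_0$ such that for every integer $A\ge A_0$ and every treasure hunt algorithm with advice for which the advice given on every configuration of $\mathcal{C}(A)$ has length at most $A/2$, there is a configuration in $\mathcal{C}(A)$ on which the cost exceeds $C\cdot L$.
   Context: Model. A terrain here is a closed polygon $\mathcal{P}$ (no obstacles). The treasure is an interior point $q$ of $\mathcal{P}$; the agent is a point starting at $p\in\mathcal{P}$, with a compass and unit of length, moving along polygonal lines in $\mathcal{P}$ (free moves interrupted detectably upon hitting the boundary, and boundary moves along the boundary). An agent at $a$ sees $b$ if the segment $ab$ lies in $\mathcal{P}$ and has length at most $1$. The agent initially knows neither the polygon nor $q$. A treasure hunt algorithm with advice: an oracle knowing $\mathcal{P}$, $p$ and $q$ gives the agent a binary string (advice) before it starts; the agent's deterministic algorithm uses this string. The cost is the length of the trajectory until the agent first sees the treasure. The accessibility of the treasure is $\lambda=\min(1,\rho)$, $\rho$ being the largest radius of a disc centered at $q$ contained in $\mathcal{P}$. *)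

(* Defs.v *)
From Stdlib Require Import Reals Lra List ClassicalEpsilon.
Open Scope R_scope.

Definition point := (R * R)%type.
Definition padd (a b : point) : point := (fst a + fst b, snd a + snd b).
Definition psub (a b : point) : point := (fst a - fst b, snd a - snd b).
Definition pscale (t : R) (a : point) : point := (t * fst a, t * snd a).
Definition dot (a b : point) : R := fst a * fst b + snd a * snd b.
Definition cross (a b : point) : R := fst a * snd b - snd a * fst b.
Definition dist (a b : point) : R := sqrt (dot (psub a b) (psub a b)).
Definition lerp (a b : point) (t : R) : point := padd a (pscale t (psub b a)).

Definition pset := point -> Prop.
Definition interior (S : pset) (x : point) : Prop :=
  exists e, 0 < e /\ forall y, dist x y < e -> S y.
Definition closure (S : pset) (x : point) : Prop :=
  forall e, 0 < e -> exists y, dist x y < e /\ S y.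
Definition boundary (S : pset) (x : point) : Prop := closure S x /\ ~ interior S x.
Definition closed (S : pset) : Prop := forall x, closure S x -> S x.
Definition bounded (S : pset) : Prop := exists M, forall x, S x -> dist (0,0) x <= M.
Definition convex (S : pset) : Prop :=
  forall a b t, S a -> S b -> 0 <= t <= 1 -> S (lerp a b t).
Definition on_seg (a b x : point) : Prop := exists t, 0 <= t <= 1 /\ x = lerp a b t.
Definition seg_in (S : pset) (a b : point) : Prop := forall x, on_seg a b x -> S x.

Definition vtx (V : list point) (i : nat) : point := nth (i mod length V) V (0,0).
Definition edge_pt (V : list point) (i : nat) (x : point) : Prop :=
  on_seg (vtx V i) (vtx V (S i)) x.
Definition chain (V : list point) (x : point) : Prop :=
  exists i, (i < length V)%nat /\ edge_pt V i x.
Definition simple_chain (V : list point) : Prop :=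
  (3 <= length V)%nat /\
  forall i j, (i < length V)%nat -> (j < length V)%nat -> i <> j ->
    forall x, edge_pt V i x -> edge_pt V j x ->
      (j = (S i) mod length V /\ x = vtx V j) \/
      (i = (S j) mod length V /\ x = vtx V i).
Fixpoint area2_aux (V : list point) (first : point) : R :=
  match V with
  | nil => 0
  | a :: nil => cross a first
  | a :: ((b :: _) as V') => cross a b + area2_aux V' first
  end.
(* twice the signed area *)
Definition area2 (V : list point) : R :=
  match V with nil => 0 | a :: _ => area2_aux V a end.
(* the closed region S is the polygon bounded by the simple chain V, and V is
   listed counterclockwise (so that the compass-oriented agent can refer to
   the two boundary orientations) *)
Definition is_polygon (V : list point) (Sr : pset) : Prop :=
  simple_chain V /\ 0 < area2 V /\
  closed Sr /\ bounded Sr /\ (exists x, interior Sr x) /\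
  (forall x, boundary Sr x <-> chain V x).

Record config := Config {
  verts : list point;
  region : pset;
  start : point;
  treasure : point
}.
Definition is_config (c : config) : Prop :=
  is_polygon (verts c) (region c) /\ region c (start c) /\
  interior (region c) (treasure c).

Fixpoint poly_len (a : point) (ws : list point) : R :=
  match ws with nil => 0 | w :: ws' => dist a w + poly_len w ws' end.
Fixpoint poly_in (Sr : pset) (a : point) (ws : list point) : Prop :=
  match ws with nil => True | w :: ws' => seg_in Sr a w /\ poly_in Sr w ws' end.
Definition path_length (Sr : pset) (a b : point) (l : R) : Prop :=
  exists ws, poly_in Sr a (ws ++ b :: nil) /\ l = poly_len a (ws ++ b :: nil).
Definition is_inf (E : R -> Prop) (m : R) : Prop :=
  (forall x, E x -> m <= x) /\ (forall m', (forall x, E x -> m' <= x) -> m' <= m).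
Definition is_sup (E : R -> Prop) (m : R) : Prop :=
  (forall x, E x -> x <= m) /\ (forall m', (forall x, E x -> x <= m') -> m <= m').
Definition geodist (c : config) : R :=
  epsilon (inhabits 0) (is_inf (path_length (region c) (start c) (treasure c))).

Definition disc_in (Sr : pset) (q : point) (r : R) : Prop :=
  0 <= r /\ forall x, dist q x < r -> Sr x.
Definition rho (c : config) : R :=
  epsilon (inhabits 0) (is_sup (disc_in (region c) (treasure c))).
Definition accessibility (c : config) : R := Rmin 1 (rho c).

Definition sees (Sr : pset) (a b : point) : Prop := seg_in Sr a b /\ dist a b <= 1.

(* Free v: free move along the segment from the current position x to x+v,
   interrupted at the first point where it hits the boundary.
   Bnd o d: move along the boundary, in counterclockwise (o = true) or
   clockwise (o = false) direction, by distance |d|, stopping earlier if the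
   next vertex is reached (longer boundary walks are sequences of such moves). *)
Inductive instr := Free (v : point) | Bnd (ccw : bool) (d : R).
(* what the agent perceives after a move: its new position relative to the
   start (compass + unit of length), whether the move was interrupted / stopped
   at a vertex, and whether it now touches the boundary *)
Record obs := Obs { rel_pos : point; stopped : bool; touching : bool }.
Definition algorithm := list bool -> list obs -> instr.

Definition bool_of {P Q : Prop} (s : {P} + {Q}) : bool := if s then true else false.

Definition free_good (Sr : pset) (a b : point) (t : R) : Prop :=
  0 <= t <= 1 /\ forall s, 0 < s < t -> interior Sr (lerp a b s).
Definition free_param (Sr : pset) (a b : point) : R :=
  epsilon (inhabits 0)
    (fun t => free_good Sr a b t /\ forall t', free_good Sr a b t' -> t' <= t).

Definition in_co (a b x : point) : bool :=
  bool_of (Req_EM_T (cross (psub b a) (psub x a)) 0) &&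
  bool_of (Rle_dec 0 (dot (psub x a) (psub b a))) &&
  bool_of (Rlt_dec (dot (psub x a) (psub b a)) (dot (psub b a) (psub b a))).
Definition in_oc (a b x : point) : bool :=
  bool_of (Req_EM_T (cross (psub b a) (psub x a)) 0) &&
  bool_of (Rlt_dec 0 (dot (psub x a) (psub b a))) &&
  bool_of (Rle_dec (dot (psub x a) (psub b a)) (dot (psub b a) (psub b a))).

Definition bnd_target (V : list point) (o : bool) (x : point) : option point :=
  if o then
    match find (fun i => in_co (vtx V i) (vtx V (S i)) x) (seq 0 (length V)) with
    | Some i => Some (vtx V (S i)) | None => None end
  else
    match find (fun i => in_oc (vtx V i) (vtx V (S i)) x) (seq 0 (length V)) with
    | Some i => Some (vtx V i) | None => None end.

Definition exec (c : config) (x : point) (ins : instr) : point * bool :=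
  match ins with
  | Free v =>
      let b := padd x v in
      let t := free_param (region c) x b in
      (lerp x b t, bool_of (Rlt_dec t 1))
  | Bnd o d =>
      match bnd_target (verts c) o x with
      | None => (x, false)
      | Some w =>
          let l := dist x w in
          if Rle_dec l (Rabs d) then (w, true)
          else (lerp x w (Rabs d / l), false)
      end
  end.

Definition touching_b (c : config) (x : point) : bool :=
  bool_of (excluded_middle_informative (boundary (region c) x)).

Fixpoint run (alg : algorithm) (adv : list bool) (c : config) (k : nat)
  : point * list obs :=
  match k with
  | O => (start c, nil)
  | S k' =>
      let (x, h) := run alg adv c k' in
      let (y, f) := exec c x (alg adv h) in
      (y, h ++ Obs (psub y (start c)) f (touching_b c y) :: nil)
  end.
Definition waypoint alg adv c k : point := fst (run alg adv c k).
Fixpoint travelled alg adv c (k : nat) : R :=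
  match k with
  | O => 0
  | S k' => travelled alg adv c k' + dist (waypoint alg adv c k') (waypoint alg adv c k)
  end.

Definition sees_within (alg : algorithm) (adv : list bool) (c : config) (B : R) : Prop :=
  exists k t, 0 <= t <= 1 /\
    let a := waypoint alg adv c k in
    let b := waypoint alg adv c (S k) in
    travelled alg adv c k + t * dist a b <= B /\
    sees (region c) (lerp a b t) (treasure c).
Definition cost_exceeds (alg : algorithm) (adv : list bool) (c : config) (B : R) : Prop :=
  ~ sees_within alg adv c B.

(* Main.v *)
(* A comb has a triangular room with N thin teeth of depth 1; at the bottom of one tooth the walls
   open onto a large chamber holding the treasure at depth A, so that L is between A + 1 and A + 2.
   Before it reaches the bottom of that tooth, the agent behaves as in the comb without chamber,
   and there each newly explored tooth costs at least 1, since two teeth communicate only through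
   the room. At cost C (A + 2) it explores a number of teeth bounded independently of N with each
   of the boundedly many advice strings, hence it fails for some tooth once N is large. *)

From Stdlib Require Import Reals Lra Lia List ClassicalEpsilon Classical Arith.
Require Import Defs.
Open Scope R_scope.

(** * Plane geometry and moves *)

(** All teeth hang below one unit segment, so their number can grow without changing the length
    scale; this is why [N] may be chosen last, after [C] and [A]. The obstacle is that runs in two
    different polygons must coincide exactly, although a free move stops at the first contact with
    the boundary and a boundary move scans the vertex list by index. Three choices answer this. The
    chamber arises by moving two vertices, not by adding any, so indices keep their meaning. The two
    regions differ only inside a closed cone hanging from the bottom of the tooth. The reference
    comb is contained in the other one, so that a free move ending off the cone in the reference
    comb ends at the same point in both. Regions are sets where a continuous function is
    nonnegative, with minima for intersections and maxima for unions, so closedness and interior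
    points are read off from signs. *)

Lemma dist_formula (a b : point) :
  dist a b = sqrt ((fst a - fst b) * (fst a - fst b) + (snd a - snd b) * (snd a - snd b)).
Proof. reflexivity. Qed.

Lemma dist_fst (a b : point) : Rabs (fst a - fst b) <= dist a b.
Proof.
  rewrite dist_formula, <- sqrt_Rsqr_abs. apply sqrt_le_1_alt. unfold Rsqr.
  pose proof (Rle_0_sqr (snd a - snd b)) as H. unfold Rsqr in H. lra.
Qed.

Lemma dist_snd (a b : point) : Rabs (snd a - snd b) <= dist a b.
Proof.
  rewrite dist_formula, <- sqrt_Rsqr_abs. apply sqrt_le_1_alt. unfold Rsqr.
  pose proof (Rle_0_sqr (fst a - fst b)) as H. unfold Rsqr in H. lra.
Qed.

Lemma dist_pos (a b : point) : 0 <= dist a b.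
Proof. apply sqrt_pos. Qed.

Lemma dist_le_abs (a b : point) :
  dist a b <= Rabs (fst a - fst b) + Rabs (snd a - snd b).
Proof.
  rewrite dist_formula.
  pose proof (Rabs_pos (fst a - fst b)). pose proof (Rabs_pos (snd a - snd b)).
  rewrite <- (sqrt_square (Rabs (fst a - fst b) + Rabs (snd a - snd b))) by lra.
  apply sqrt_le_1_alt.
  pose proof (Rsqr_abs (fst a - fst b)) as E1. pose proof (Rsqr_abs (snd a - snd b)) as E2.
  unfold Rsqr in E1, E2. rewrite E1, E2. nra.
Qed.

Lemma dist_refl (a : point) : dist a a = 0.
Proof.
  apply Rle_antisym; [|apply dist_pos].
  eapply Rle_trans; [apply dist_le_abs|].
  rewrite !Rminus_diag, Rabs_R0. lra.
Qed.

Lemma dist_vertical (x y y' : R) : dist (x, y) (x, y') = Rabs (y - y').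
Proof.
  apply Rle_antisym; [|apply (dist_snd (x, y) (x, y'))].
  eapply Rle_trans; [apply dist_le_abs|].
  simpl. rewrite Rminus_diag, Rabs_R0. lra.
Qed.

Lemma dist_horizontal (x x' y : R) : dist (x, y) (x', y) = Rabs (x - x').
Proof.
  apply Rle_antisym; [|apply (dist_fst (x, y) (x', y))].
  eapply Rle_trans; [apply dist_le_abs|].
  simpl. rewrite Rminus_diag, Rabs_R0. lra.
Qed.

Lemma fst_lerp (a b : point) (t : R) : fst (lerp a b t) = fst a + t * (fst b - fst a).
Proof. reflexivity. Qed.

Lemma snd_lerp (a b : point) (t : R) : snd (lerp a b t) = snd a + t * (snd b - snd a).
Proof. reflexivity. Qed.

Lemma point_eq (a b : point) : fst a = fst b -> snd a = snd b -> a = b.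
Proof. destruct a, b; simpl; congruence. Qed.

Lemma lerp_0 (a b : point) : lerp a b 0 = a.
Proof. apply point_eq; rewrite ?fst_lerp, ?snd_lerp; ring. Qed.

Lemma lerp_1 (a b : point) : lerp a b 1 = b.
Proof. apply point_eq; rewrite ?fst_lerp, ?snd_lerp; ring. Qed.

Lemma lerp_same (a : point) (t : R) : lerp a a t = a.
Proof. apply point_eq; rewrite ?fst_lerp, ?snd_lerp; ring. Qed.

Lemma lerp_lerp (a b : point) (t s : R) : lerp a (lerp a b t) s = lerp a b (s * t).
Proof. apply point_eq; rewrite ?fst_lerp, ?snd_lerp, ?fst_lerp, ?snd_lerp; ring. Qed.

Lemma dist_lerp_lerp (a b : point) (s t : R) :
  dist (lerp a b s) (lerp a b t) <=
  Rabs (s - t) * (Rabs (fst b - fst a) + Rabs (snd b - snd a)).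
Proof.
  eapply Rle_trans; [apply dist_le_abs|].
  rewrite !fst_lerp, !snd_lerp, Rmult_plus_distr_l, <- !Rabs_mult.
  right; f_equal; f_equal; ring.
Qed.

Lemma on_seg_sub (a b x y z : point) :
  on_seg a b x -> on_seg a b y -> on_seg x y z -> on_seg a b z.
Proof.
  intros (s & Hs & ->) (t & Ht & ->) (r & Hr & ->).
  exists (s + r * (t - s)); split; [nra|].
  apply point_eq; rewrite ?fst_lerp, ?snd_lerp, ?fst_lerp, ?snd_lerp; ring.
Qed.

Lemma on_seg_l (a b : point) : on_seg a b a.
Proof. exists 0; split; [lra|]. now rewrite lerp_0. Qed.

Lemma on_seg_r (a b : point) : on_seg a b b.
Proof. exists 1; split; [lra|]. now rewrite lerp_1. Qed.

Lemma on_seg_sym (a b z : point) : on_seg a b z -> on_seg b a z.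
Proof.
  intros (t & Ht & ->). exists (1 - t). split; [lra|].
  apply point_eq; rewrite !fst_lerp || rewrite !snd_lerp; ring.
Qed.

Lemma on_seg_fst (a b z : point) :
  fst a < fst b ->
  (on_seg a b z <-> fst a <= fst z <= fst b /\
     (snd z - snd a) * (fst b - fst a) = (snd b - snd a) * (fst z - fst a)).
Proof.
  intros H. split.
  - intros (t & Ht & ->). rewrite fst_lerp, snd_lerp. split; [nra|ring].
  - intros [Hx E]. exists ((fst z - fst a) / (fst b - fst a)).
    assert ((fst z - fst a) / (fst b - fst a) * (fst b - fst a) = fst z - fst a) as Et
      by (field; lra).
    set (t := _ / _) in *. clearbody t. split; [nra|].
    apply point_eq; rewrite ?fst_lerp, ?snd_lerp; [lra|].
    apply (Rmult_eq_reg_r (fst b - fst a)); [|lra]. nra.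
Qed.

Lemma on_seg_snd (a b z : point) :
  snd a < snd b ->
  (on_seg a b z <-> snd a <= snd z <= snd b /\
     (fst z - fst a) * (snd b - snd a) = (fst b - fst a) * (snd z - snd a)).
Proof.
  intros H. split.
  - intros (t & Ht & ->). rewrite fst_lerp, snd_lerp. split; [nra|ring].
  - intros [Hx E]. exists ((snd z - snd a) / (snd b - snd a)).
    assert ((snd z - snd a) / (snd b - snd a) * (snd b - snd a) = snd z - snd a) as Et
      by (field; lra).
    set (t := _ / _) in *. clearbody t. split; [nra|].
    apply point_eq; rewrite ?fst_lerp, ?snd_lerp; [|lra].
    apply (Rmult_eq_reg_r (snd b - snd a)); [|lra]. nra.
Qed.

(** * Sets given by the sign of a continuous function *)

Definition continuous_gap (g : point -> R) : Prop :=
  forall z e, 0 < e -> exists d, 0 < d /\ forall y, dist z y < d -> Rabs (g z - g y) < e.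

Lemma continuous_gap_const (c : R) : continuous_gap (fun _ => c).
Proof.
  intros z e He; exists 1; split; [lra|]. intros. now rewrite Rminus_diag, Rabs_R0.
Qed.

Lemma continuous_gap_fst : continuous_gap fst.
Proof.
  intros z e He; exists e; split; [lra|]. intros y Hy.
  pose proof (dist_fst z y). lra.
Qed.

Lemma continuous_gap_snd : continuous_gap snd.
Proof.
  intros z e He; exists e; split; [lra|]. intros y Hy.
  pose proof (dist_snd z y). lra.
Qed.

(** Any [op] that is 1-Lipschitz for the sum norm is covered, which serves sums, minima and maxima
    at once. *)
Lemma continuous_gap_bin (op : R -> R -> R) (g h : point -> R) :
  (forall a b a' b', Rabs (op a b - op a' b') <= Rabs (a - a') + Rabs (b - b')) ->
  continuous_gap g -> continuous_gap h -> continuous_gap (fun z => op (g z) (h z)).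
Proof.
  intros Hop Hg Hh z e He.
  destruct (Hg z (e / 2)) as (d1 & Hd1 & K1); [lra|].
  destruct (Hh z (e / 2)) as (d2 & Hd2 & K2); [lra|].
  exists (Rmin d1 d2); split; [now apply Rmin_glb_lt|]. intros y Hy.
  specialize (K1 y). specialize (K2 y).
  pose proof (Rmin_l d1 d2). pose proof (Rmin_r d1 d2).
  eapply Rle_lt_trans; [apply Hop|].
  assert (Rabs (g z - g y) < e / 2) by (apply K1; lra).
  assert (Rabs (h z - h y) < e / 2) by (apply K2; lra). lra.
Qed.

Ltac split_abs :=
  repeat match goal with
  | |- context [Rabs ?a] => unfold Rabs at 1; destruct (Rcase_abs a)
  | H : context [Rabs ?a] |- _ => unfold Rabs at 1 in H; destruct (Rcase_abs a)
  end.

Lemma continuous_gap_plus (g h : point -> R) :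
  continuous_gap g -> continuous_gap h -> continuous_gap (fun z => g z + h z).
Proof. apply continuous_gap_bin. intros; split_abs; lra. Qed.

Lemma continuous_gap_min (g h : point -> R) :
  continuous_gap g -> continuous_gap h -> continuous_gap (fun z => Rmin (g z) (h z)).
Proof.
  apply continuous_gap_bin. intros a b a' b'. unfold Rmin.
  destruct (Rle_dec a b), (Rle_dec a' b'); split_abs; lra.
Qed.

Lemma continuous_gap_max (g h : point -> R) :
  continuous_gap g -> continuous_gap h -> continuous_gap (fun z => Rmax (g z) (h z)).
Proof.
  apply continuous_gap_bin. intros a b a' b'. unfold Rmax.
  destruct (Rle_dec a b), (Rle_dec a' b'); split_abs; lra.
Qed.

Lemma continuous_gap_scal (c : R) (g : point -> R) :
  continuous_gap g -> continuous_gap (fun z => c * g z).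
Proof.
  intros Hg z e He.
  pose proof (Rabs_pos c) as Hc.
  destruct (Hg z (e / (Rabs c + 1))) as (d & Hd & K).
  { apply Rdiv_lt_0_compat; lra. }
  exists d; split; [exact Hd|]. intros y Hy.
  replace (c * g z - c * g y) with (c * (g z - g y)) by ring.
  rewrite Rabs_mult.
  specialize (K y Hy). pose proof (Rabs_pos (g z - g y)).
  assert (e = (Rabs c + 1) * (e / (Rabs c + 1))) as -> by (field; lra).
  set (q := e / (Rabs c + 1)) in *. clearbody q. nra.
Qed.

Lemma continuous_gap_abs (g : point -> R) :
  continuous_gap g -> continuous_gap (fun z => Rabs (g z)).
Proof.
  intros Hg z e He. destruct (Hg z e He) as (d & Hd & K).
  exists d; split; [exact Hd|]. intros y Hy.
  eapply Rle_lt_trans; [apply Rabs_triang_inv2|auto].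
Qed.

Lemma gap_open (g : point -> R) (z : point) :
  continuous_gap g -> 0 < g z -> exists d, 0 < d /\ forall y, dist z y < d -> 0 < g y.
Proof.
  intros Hg Hz. destruct (Hg z (g z) Hz) as (d & Hd & K).
  exists d; split; [exact Hd|]. intros y Hy. specialize (K y Hy). split_abs; lra.
Qed.

Lemma gap_closed (g : point -> R) (S : pset) :
  continuous_gap g -> (forall z, S z <-> 0 <= g z) -> closed S.
Proof.
  intros Hg HS z Hz. apply HS. destruct (Rle_or_lt 0 (g z)) as [|Hn]; [assumption|exfalso].
  destruct (Hg z (- g z)) as (d & Hd & K); [lra|].
  destruct (Hz d Hd) as (y & Hy & Sy). specialize (K y Hy). apply HS in Sy. split_abs; lra.
Qed.

Lemma closure_incl (S : pset) (z : point) : S z -> closure S z.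
Proof. intros H e He. exists z; split; [now rewrite dist_refl|exact H]. Qed.

Lemma interior_incl (S : pset) (z : point) : interior S z -> S z.
Proof. intros (e & He & K). apply K. now rewrite dist_refl. Qed.

Lemma interior_mono (S T : pset) (z : point) :
  (forall y, S y -> T y) -> interior S z -> interior T z.
Proof. intros H (e & He & K). exists e; auto. Qed.

Lemma closed_compl_open (D : pset) (z : point) :
  closed D -> ~ D z -> exists e, 0 < e /\ forall y, dist z y < e -> ~ D y.
Proof.
  intros HD Hz. apply NNPP. intros Hn. apply Hz, HD. intros e He.
  apply NNPP. intros Hm. apply Hn. exists e; split; [exact He|].
  intros y Hy Dy. apply Hm. now exists y.
Qed.

(** * Free moves, and their comparison in two regions *)

Lemma free_param_spec (S : pset) (a b : point) :
  free_good S a b (free_param S a b) /\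
  forall t, free_good S a b t -> t <= free_param S a b.
Proof.
  unfold free_param. apply epsilon_spec.
  destruct (completeness (free_good S a b)) as [m [Hub Hlub]].
  - exists 1. intros t [Ht _]. lra.
  - exists 0. split; [lra|]. intros; lra.
  - exists m. split; [split|exact Hub].
    + split; [apply Hub; split; [lra|intros; lra]|apply Hlub; intros t [Ht _]; lra].
    + intros s [Hs0 Hs]. apply NNPP; intros Hn.
      assert (m <= s); [|lra]. apply Hlub. intros t [Ht Gt].
      destruct (Rle_or_lt t s); [assumption|]. exfalso; apply Hn, Gt; lra.
Qed.

Lemma free_seg_in (S : pset) (a b : point) :
  closed S -> S a -> seg_in S a (lerp a b (free_param S a b)).
Proof.
  intros HS Ha z (s & Hs & ->). rewrite lerp_lerp.
  destruct (free_param_spec S a b) as [[Ht G] _].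
  set (t := free_param S a b) in *. clearbody t.
  destruct (Rle_lt_dec (s * t) 0) as [H0|H0].
  { replace (s * t) with 0 by nra. now rewrite lerp_0. }
  apply HS. intros e He.
  set (M := Rabs (fst b - fst a) + Rabs (snd b - snd a)).
  assert (0 <= M) by
    (pose proof (Rabs_pos (fst b - fst a)); pose proof (Rabs_pos (snd b - snd a));
     unfold M; lra).
  assert (0 < e / (M + 1)) by (apply Rdiv_lt_0_compat; lra).
  assert (e = (M + 1) * (e / (M + 1))) as Ee by (field; lra).
  set (q := e / (M + 1)) in *. clearbody q.
  (* A parameter slightly below [s * t] is strictly before the stop, hence interior; closedness then
     covers the end point of the move as well. *)
  assert (exists r, 0 < r < t /\ Rabs (s * t - r) <= q / 2) as (r & Hr & Hq).
  { exists (s * t - Rmin (q / 2) (s * t / 2)).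
    assert (0 < Rmin (q / 2) (s * t / 2)) by (apply Rmin_glb_lt; lra).
    pose proof (Rmin_l (q / 2) (s * t / 2)). pose proof (Rmin_r (q / 2) (s * t / 2)).
    split; [nra|]. split_abs; lra. }
  exists (lerp a b r); split.
  - eapply Rle_lt_trans; [apply dist_lerp_lerp|]. fold M. nra.
  - apply interior_incl, G, Hr.
Qed.

Section Agreement.

Variables (S T D : pset).
Hypothesis HD : closed D.
Hypothesis Hsub : forall y, S y -> T y.
Hypothesis Hagree : forall y, ~ D y -> T y -> S y.

Lemma interior_agree (z : point) : ~ D z -> interior T z -> interior S z.
Proof.
  intros Hz (e & He & K). destruct (closed_compl_open D z HD Hz) as (d & Hd & L).
  exists (Rmin e d); split; [now apply Rmin_glb_lt|].
  pose proof (Rmin_l e d). pose proof (Rmin_r e d).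
  intros y Hy. apply Hagree; [apply L; lra|apply K; lra].
Qed.

Lemma boundary_agree (z : point) : ~ D z -> (boundary S z <-> boundary T z).
Proof.
  intros Hz. split; intros [Hc Hi]; split.
  - intros e He. destruct (Hc e He) as (y & Hy & Sy). exists y; auto.
  - intros K. now apply Hi, interior_agree.
  - intros e He. destruct (closed_compl_open D z HD Hz) as (d & Hd & L).
    destruct (Hc (Rmin e d)) as (y & Hy & Ty); [now apply Rmin_glb_lt|].
    pose proof (Rmin_l e d). pose proof (Rmin_r e d).
    exists y; split; [lra|]. apply Hagree; [apply L; lra|exact Ty].
  - intros K. apply Hi. now apply (interior_mono S T).
Qed.

(** Up to the stop in [S] all points are interior to the larger [T], so the move in [T] goes at
    least as far, even if it crosses [D] on the way. If it went farther, then near the stop, where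
    the regions coincide, [S] would also allow a longer move. So only the end point has to avoid
    [D]. *)
Lemma free_param_agree (a b : point) :
  ~ D (lerp a b (free_param S a b)) -> free_param T a b = free_param S a b.
Proof.
  destruct (free_param_spec S a b) as [[Ht G] M].
  destruct (free_param_spec T a b) as [[Ht' G'] M'].
  set (t := free_param S a b) in *. set (t' := free_param T a b) in *.
  clearbody t t'. intros Hz.
  apply Rle_antisym.
  2:{ apply M'. split; [exact Ht|]. intros s Hs. apply (interior_mono S T); auto. }
  destruct (Rle_or_lt t' t) as [|Hlt]; [assumption|exfalso].
  destruct (closed_compl_open D _ HD Hz) as (d & Hd & L).
  set (B := Rabs (fst b - fst a) + Rabs (snd b - snd a)).
  assert (0 <= B) by
    (pose proof (Rabs_pos (fst b - fst a)); pose proof (Rabs_pos (snd b - snd a));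
     unfold B; lra).
  assert (0 < d / (B + 1)) by (apply Rdiv_lt_0_compat; lra).
  assert (d = (B + 1) * (d / (B + 1))) as Ee by (field; lra).
  set (q := d / (B + 1)) in *. clearbody q.
  set (r := Rmin q (t' - t)).
  assert (0 < r) by (apply Rmin_glb_lt; lra).
  pose proof (Rmin_l q (t' - t)). pose proof (Rmin_r q (t' - t)). fold r in H2, H3.
  assert (t + r <= t); [|lra]. apply M. split; [lra|]. intros s Hs.
  destruct (Rlt_or_le s t) as [Hst|Hst]; [apply G; lra|].
  apply interior_agree; [|apply G'; lra].
  apply L. eapply Rle_lt_trans; [apply dist_lerp_lerp|]. fold B.
  rewrite Rabs_left1 by lra. nra.
Qed.

End Agreement.

(** * Boundary moves *)

Lemma bool_of_true {P Q : Prop} (s : {P} + {Q}) : bool_of s = true -> P.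
Proof. destruct s; simpl; [trivial|discriminate]. Qed.

Lemma cross_dot_on_seg (a b x : point) :
  cross (psub b a) (psub x a) = 0 ->
  0 <= dot (psub x a) (psub b a) <= dot (psub b a) (psub b a) ->
  0 < dot (psub b a) (psub b a) -> on_seg a b x.
Proof.
  destruct a as [a1 a2], b as [b1 b2], x as [x1 x2].
  unfold cross, dot, psub; simpl. intros Hc Hd Hp.
  set (n := (b1 - a1) * (b1 - a1) + (b2 - a2) * (b2 - a2)) in *.
  (* Parameter of the orthogonal projection onto the line; as the cross product vanishes, the
     projection is [x] itself. *)
  exists (((x1 - a1) * (b1 - a1) + (x2 - a2) * (b2 - a2)) / n). split.
  - split; [apply Rle_mult_inv_pos; lra|].
    apply (Rmult_le_reg_r n); [lra|]. unfold Rdiv. rewrite Rmult_assoc, Rinv_l by lra. lra.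
  - assert (((x1 - a1) * (b1 - a1) + (x2 - a2) * (b2 - a2)) / n * n =
            (x1 - a1) * (b1 - a1) + (x2 - a2) * (b2 - a2)) as E by (field; lra).
    set (t := _ / n) in *. clearbody t.
    apply point_eq; rewrite ?fst_lerp, ?snd_lerp; simpl; apply (Rmult_eq_reg_r n); try lra.
    + replace ((a1 + t * (b1 - a1)) * n) with (a1 * n + t * n * (b1 - a1)) by ring.
      rewrite E. unfold n.
      replace (x1 * _) with (a1 * ((b1 - a1) * (b1 - a1) + (b2 - a2) * (b2 - a2))
        + ((x1 - a1) * (b1 - a1) + (x2 - a2) * (b2 - a2)) * (b1 - a1)
        - (b2 - a2) * ((b1 - a1) * (x2 - a2) - (b2 - a2) * (x1 - a1))) by ring.
      rewrite Hc. ring.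
    + replace ((a2 + t * (b2 - a2)) * n) with (a2 * n + t * n * (b2 - a2)) by ring.
      rewrite E. unfold n.
      replace (x2 * _) with (a2 * ((b1 - a1) * (b1 - a1) + (b2 - a2) * (b2 - a2))
        + ((x1 - a1) * (b1 - a1) + (x2 - a2) * (b2 - a2)) * (b2 - a2)
        + (b1 - a1) * ((b1 - a1) * (x2 - a2) - (b2 - a2) * (x1 - a1))) by ring.
      rewrite Hc. ring.
Qed.

Lemma in_co_on_seg (a b x : point) : in_co a b x = true -> on_seg a b x.
Proof.
  unfold in_co. rewrite !Bool.andb_true_iff. intros [[H1 H2] H3].
  apply bool_of_true in H1, H2, H3. apply cross_dot_on_seg; lra.
Qed.

Lemma in_oc_on_seg (a b x : point) : in_oc a b x = true -> on_seg a b x.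
Proof.
  unfold in_oc. rewrite !Bool.andb_true_iff. intros [[H1 H2] H3].
  apply bool_of_true in H1, H2, H3. apply cross_dot_on_seg; lra.
Qed.

Lemma bnd_target_edge (V : list point) (o : bool) (x w : point) :
  bnd_target V o x = Some w ->
  exists k, (k < length V)%nat /\ edge_pt V k x /\ edge_pt V k w.
Proof.
  unfold bnd_target, edge_pt. destruct o.
  - destruct (find _ _) as [k|] eqn:E; [|discriminate]. intros [= <-].
    apply find_some in E. destruct E as [E1 E2]. apply in_seq in E1.
    exists k. repeat split; [lia|now apply in_co_on_seg|apply on_seg_r].
  - destruct (find _ _) as [k|] eqn:E; [|discriminate]. intros [= <-].
    apply find_some in E. destruct E as [E1 E2]. apply in_seq in E1.
    exists k. repeat split; [lia|now apply in_oc_on_seg|apply on_seg_l].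
Qed.

(** The two scans run over the same indices: an edge either has the same ends in both lists, or is
    rejected by both scans because [x] is not on it. *)
Lemma bnd_target_agree (V W : list point) (o : bool) (x : point) :
  length V = length W ->
  (forall k, (k < length V)%nat ->
     (vtx V k = vtx W k /\ vtx V (S k) = vtx W (S k)) \/
     (~ edge_pt V k x /\ ~ edge_pt W k x)) ->
  bnd_target V o x = bnd_target W o x.
Proof.
  intros HL H. unfold bnd_target. rewrite <- HL. clear HL. unfold edge_pt in H.
  assert (forall k, In k (seq 0 (length V)) -> (k < length V)%nat) as Hin
    by (intros k Hk; apply in_seq in Hk; lia).
  destruct o.
  - induction (seq 0 (length V)) as [|k l IH]; [reflexivity|]. simpl.
    destruct (H k) as [[E1 E2]|[N1 N2]]; [apply Hin; now left| |].
    + rewrite E1, E2. destruct (in_co _ _ x); [rewrite ?E2; reflexivity|apply IH].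
      intros; apply Hin; now right.
    + destruct (in_co (vtx V k) _ x) eqn:F1; [now apply in_co_on_seg in F1|].
      destruct (in_co (vtx W k) _ x) eqn:F2; [now apply in_co_on_seg in F2|].
      apply IH. intros; apply Hin; now right.
  - induction (seq 0 (length V)) as [|k l IH]; [reflexivity|]. simpl.
    destruct (H k) as [[E1 E2]|[N1 N2]]; [apply Hin; now left| |].
    + rewrite E1, E2. destruct (in_oc _ _ x); [rewrite ?E1; reflexivity|apply IH].
      intros; apply Hin; now right.
    + destruct (in_oc (vtx V k) _ x) eqn:F1; [now apply in_oc_on_seg in F1|].
      destruct (in_oc (vtx W k) _ x) eqn:F2; [now apply in_oc_on_seg in F2|].
      apply IH. intros; apply Hin; now right.
Qed.

Lemma exec_seg_in (c : config) (x : point) (ins : instr) :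
  closed (region c) -> (forall z, chain (verts c) z -> region c z) ->
  region c x -> seg_in (region c) x (fst (exec c x ins)).
Proof.
  intros Hcl Hch Hx. destruct ins as [v|o d]; simpl.
  - now apply free_seg_in.
  - destruct (bnd_target _ o x) as [w|] eqn:E; simpl.
    2:{ intros z (t & _ & ->). now rewrite lerp_same. }
    apply bnd_target_edge in E. destruct E as (k & Hk & Ex & Ew).
    assert (forall z, on_seg x w z -> region c z) as Hs.
    { intros z Hz. apply Hch. exists k; split; [exact Hk|].
      exact (on_seg_sub _ _ _ _ _ Ex Ew Hz). }
    destruct (Rle_dec (dist x w) (Rabs d)) as [|Hd]; simpl; [exact Hs|].
    intros z Hz. apply Hs.
    assert (on_seg x w (lerp x w (Rabs d / dist x w))) as Hw.
    { exists (Rabs d / dist x w). split; [|reflexivity].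
      pose proof (Rabs_pos d). split; [apply Rle_mult_inv_pos; lra|].
      apply (Rmult_le_reg_r (dist x w)); [lra|]. unfold Rdiv.
      rewrite Rmult_assoc, Rinv_l by lra. lra. }
    eapply on_seg_sub; [apply on_seg_l|exact Hw|exact Hz].
Qed.

(** * The combs *)

(* Vertex [k <= 5 N] has abscissa [spacing * k]; the multiples of 5 are the valleys (height 0),
   and the four vertices between two valleys form the flat bottom of a tooth (height -1), where
   the middle two of tooth [i] are pulled away to the far side of the chamber. Vertex [5 N + 1]
   closes the triangular room above the teeth. *)
Definition spacing (N : nat) : R := / (5 * INR N).

Definition rest_height (k : nat) : R := if (k mod 5 =? 0)%nat then 0 else -1.

Definition comb_vertex (N : nat) (D : R) (i k : nat) : point :=
  if (k =? 5 * N + 1)%nat then (0, 1)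
  else if (k =? 5 * i + 2)%nat then (spacing N * (5 * INR i + 1) - D, - 1 - D)
  else if (k =? 5 * i + 3)%nat then (spacing N * (5 * INR i + 4) + D, - 1 - D)
  else (spacing N * INR k, rest_height k).

Definition comb_verts (N : nat) (D : R) (i : nat) : list point :=
  map (comb_vertex N D i) (seq 0 (5 * N + 2)).

(** The rock between teeth consists of spikes whose tips are the valleys and whose sides have slopes
    plus and minus the inverse of the spacing; each recursion step removes one spike. The last term
    of the base case removes the half spike at abscissa 1. Heights are multiplied by the spacing to
    avoid divisions. *)
Fixpoint wedge_gap (N n : nat) (z : point) : R :=
  match n with
  | O => Rmin (Rmin (fst z) (1 + - 1 * (fst z + snd z)))
           (Rmin (snd z + 1) (spacing N * snd z + (1 + - 1 * fst z)))
  | S m => Rmin (wedge_gap N m z)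
             (spacing N * snd z + Rabs (fst z + - (spacing N * (5 * INR m))))
  end.

Definition comb_gap (N : nat) : point -> R := wedge_gap N N.

(** The walls have slopes 1 and -1 and pass through the ends of the bottom of tooth [i]. Prolonged
    upwards they meet inside the tooth, and this overlap makes the points of the opening interior to
    the union. *)
Definition chamber_gap (N : nat) (D : R) (i : nat) (z : point) : R :=
  Rmin (snd z + (1 + D))
    (- 1 * snd z + (3 / 2 * spacing N - 1)
     + - 1 * Rabs (fst z + - (spacing N * (5 * INR i + 5 / 2)))).

(* For [i = N] there is no chamber: this is the reference environment the agent is simulated in. *)
Definition comb_region (N : nat) (D : R) (i : nat) : pset :=
  fun z => 0 <= comb_gap N z \/ ((i < N)%nat /\ 0 <= chamber_gap N D i z).

Lemma wedge_gap_continuous (N n : nat) : continuous_gap (wedge_gap N n).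
Proof.
  induction n; simpl; repeat first
    [ apply continuous_gap_min | apply continuous_gap_plus | apply continuous_gap_scal
    | apply continuous_gap_abs | apply continuous_gap_fst | apply continuous_gap_snd
    | apply continuous_gap_const | exact IHn ].
Qed.

Lemma chamber_gap_continuous (N : nat) (D : R) (i : nat) :
  continuous_gap (chamber_gap N D i).
Proof.
  unfold chamber_gap; repeat first
    [ apply continuous_gap_min | apply continuous_gap_plus | apply continuous_gap_scal
    | apply continuous_gap_abs | apply continuous_gap_fst | apply continuous_gap_snd
    | apply continuous_gap_const ].
Qed.

Lemma Rmin_nonneg (a b : R) : 0 <= Rmin a b <-> 0 <= a /\ 0 <= b.
Proof. unfold Rmin; destruct (Rle_dec a b); lra. Qed.

Lemma Rmin_positive (a b : R) : 0 < Rmin a b <-> 0 < a /\ 0 < b.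
Proof. unfold Rmin; destruct (Rle_dec a b); lra. Qed.

Lemma comb_gap_nonneg (N : nat) (x y : R) :
  0 <= comb_gap N (x, y) <->
  0 <= x /\ x + y <= 1 /\ - 1 <= y /\ x - 1 <= spacing N * y /\
  forall j, (j < N)%nat -> 0 <= spacing N * y + Rabs (x - spacing N * (5 * INR j)).
Proof.
  unfold comb_gap.
  enough (forall n, 0 <= wedge_gap N n (x, y) <->
    0 <= x /\ x + y <= 1 /\ - 1 <= y /\ x - 1 <= spacing N * y /\
    forall j, (j < n)%nat -> 0 <= spacing N * y + Rabs (x - spacing N * (5 * INR j))) by auto.
  induction n as [|n IH]; simpl; rewrite ?Rmin_nonneg; simpl.
  - split; intros H; repeat split; try lra. intros; lia.
  - rewrite IH. split.
    + intros [(H1 & H2 & H3 & H4 & H5) H6]. repeat split; try assumption.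
      intros j Hj. destruct (Nat.eq_dec j n) as [->|]; [exact H6|apply H5; lia].
    + intros (H1 & H2 & H3 & H4 & H5). repeat split; try assumption.
      * intros j Hj; apply H5; lia.
      * apply (H5 n); lia.
Qed.

Lemma comb_gap_positive (N : nat) (x y : R) :
  0 < x -> x + y < 1 -> - 1 < y -> x - 1 < spacing N * y ->
  (forall j, (j < N)%nat -> 0 < spacing N * y + Rabs (x - spacing N * (5 * INR j))) ->
  0 < comb_gap N (x, y).
Proof.
  intros H1 H2 H3 H4 H5. unfold comb_gap.
  enough (forall n, (n <= N)%nat -> 0 < wedge_gap N n (x, y)) by auto.
  induction n as [|n IH]; simpl; rewrite ?Rmin_positive; simpl; intros Hn.
  - lra.
  - split; [apply IH; lia|apply (H5 n); lia].
Qed.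

Lemma chamber_gap_nonneg (N : nat) (D : R) (i : nat) (x y : R) :
  0 <= chamber_gap N D i (x, y) <->
  - 1 - D <= y /\
  Rabs (x - spacing N * (5 * INR i + 5 / 2)) <= 3 / 2 * spacing N - 1 - y.
Proof.
  unfold chamber_gap. rewrite Rmin_nonneg. simpl.
  replace (x + - (spacing N * (5 * INR i + 5 / 2)))
    with (x - spacing N * (5 * INR i + 5 / 2)) by ring.
  lra.
Qed.

Lemma rest_height_block (j r : nat) :
  (r < 5)%nat -> rest_height (5 * j + r) = if (r =? 0)%nat then 0 else -1.
Proof.
  intros Hr. unfold rest_height.
  rewrite Nat.add_comm, Nat.mul_comm, Nat.Div0.mod_add, Nat.mod_small by exact Hr.
  reflexivity.
Qed.

Lemma INR_block (j r : nat) : INR (5 * j + r) = 5 * INR j + INR r.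
Proof. rewrite plus_INR, mult_INR. simpl (INR 5). ring. Qed.

Lemma block_cases (k : nat) :
  exists j r, k = (5 * j + r)%nat /\ (r = 0 \/ r = 1 \/ r = 2 \/ r = 3 \/ r = 4)%nat.
Proof.
  exists (k / 5)%nat, (k mod 5)%nat. split; [apply Nat.div_mod_eq|].
  pose proof (Nat.mod_upper_bound k 5 ltac:(lia)). lia.
Qed.

Lemma cell_cases (k : nat) :
  exists j,
    (k = (5 * j)%nat /\ INR k = 5 * INR j /\ rest_height k = 0 /\ rest_height (S k) = -1) \/
    ((k = 5 * j + 1 \/ k = 5 * j + 2 \/ k = 5 * j + 3)%nat /\
     5 * INR j + 1 <= INR k <= 5 * INR j + 3 /\ rest_height k = -1 /\ rest_height (S k) = -1) \/
    (k = (5 * j + 4)%nat /\ INR k = 5 * INR j + 4 /\ rest_height k = -1 /\ rest_height (S k) = 0).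
Proof.
  destruct (block_cases k) as (j & r & -> & Hr). exists j.
  replace (S (5 * j + r)) with (5 * j + S r)%nat by lia.
  rewrite INR_block, rest_height_block by lia.
  destruct Hr as [-> | [-> | [-> | [-> | ->]]]].
  1-4: rewrite rest_height_block by lia; simpl.
  - left. repeat split; lra || lia.
  - right; left. repeat split; lra || lia.
  - right; left. repeat split; lra || lia.
  - right; left. repeat split; lra || lia.
  - right; right. replace (5 * j + 5)%nat with (5 * S j + 0)%nat by lia.
    rewrite rest_height_block by lia. simpl. repeat split; lra || lia.
Qed.

(** Height above the line through floor vertices [k] and [k + 1] at rest, multiplied by the
    spacing. *)
Definition edge_gap (N k : nat) (x y : R) : R :=
  spacing N * y -
  (spacing N * rest_height k +
   (rest_height (S k) - rest_height k) * (x - spacing N * INR k)).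

Section Comb.

Variables (N : nat) (D : R) (i : nat).
Hypothesis HN : (0 < N)%nat.
Hypothesis HD : 8 <= D.
Hypothesis Hi : (i <= N)%nat.

Local Notation u := (spacing N).

Lemma spacing_total : u * (5 * INR N) = 1.
Proof.
  unfold spacing. apply Rinv_l. apply lt_0_INR in HN. lra.
Qed.

Lemma spacing_pos : 0 < u.
Proof. apply Rinv_0_lt_compat. apply lt_0_INR in HN. lra. Qed.

Lemma spacing_mono (j k : nat) : (j <= k)%nat -> u * INR j <= u * INR k.
Proof.
  intros H. apply Rmult_le_compat_l; [left; apply spacing_pos|now apply le_INR].
Qed.

Lemma spacing_mono_S (j k : nat) : (j < k)%nat -> u * INR j + u <= u * INR k.
Proof.
  intros H. pose proof (spacing_mono (S j) k H) as K. rewrite S_INR in K. lra.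
Qed.

Lemma spacing_le : u <= / 5.
Proof.
  pose proof (spacing_mono 1 N HN) as K. pose proof spacing_total. simpl in K. lra.
Qed.

Lemma cell_exists (x : R) :
  0 <= x <= 1 -> exists k, (k < 5 * N)%nat /\ u * INR k <= x <= u * INR k + u.
Proof.
  intros Hx.
  assert (forall n, (0 < n)%nat -> x <= u * INR n ->
            exists k, (k < n)%nat /\ u * INR k <= x <= u * INR k + u) as H.
  { induction n as [|n IH]; [lia|]. intros _ Hn. rewrite S_INR in Hn.
    destruct (Rle_or_lt x (u * INR n)) as [Hl|Hl].
    - destruct (Nat.eq_dec n 0) as [->|Hn0].
      + exists 0%nat. simpl in *. split; [lia|]. lra.
      + destruct IH as (k & Hk & K); [lia|exact Hl|]. exists k; split; [lia|exact K].
    - exists n; split; [lia|]. lra. }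
  apply H; [lia|]. pose proof spacing_total. rewrite mult_INR. simpl (INR 5). lra.
Qed.

(** The floor is the upper envelope of the bottom line and of the sides of the spikes, so over its
    own cell the line of an edge is the highest of them. *)
Lemma cell_slack (k : nat) (x y : R) :
  (k < 5 * N)%nat -> u * INR k <= x <= u * INR k + u ->
  edge_gap N k x y <= u * (y + 1) /\ edge_gap N k x y <= u * y + (1 - x) /\
  forall j, (j < N)%nat -> edge_gap N k x y <= u * y + Rabs (x - u * (5 * INR j)).
Proof.
  intros Hk Hx. unfold edge_gap.
  pose proof spacing_pos as Hu. pose proof spacing_total as Ht.
  destruct (cell_cases k) as (m & [(E & Ek & -> & ->) | [(E & Ek & -> & ->) | (E & Ek & -> & ->)]]).
  - rewrite Ek in *. pose proof (spacing_mono_S m N ltac:(lia)) as K.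
    split; [lra|split; [lra|]]. intros j Hj.
    destruct (le_lt_dec j m) as [Hm|Hm].
    + pose proof (spacing_mono _ _ Hm). split_abs; lra.
    + pose proof (spacing_mono_S _ _ Hm). split_abs; lra.
  - assert (u * (5 * INR m + 1) <= u * INR k <= u * (5 * INR m + 3)) as Ek' by nra.
    pose proof (spacing_mono_S m N ltac:(lia)) as K.
    split; [lra|split; [lra|]]. intros j Hj.
    destruct (le_lt_dec j m) as [Hm|Hm].
    + pose proof (spacing_mono _ _ Hm). split_abs; lra.
    + pose proof (spacing_mono_S _ _ Hm). split_abs; lra.
  - rewrite Ek in *. pose proof (spacing_mono_S m N ltac:(lia)) as K.
    split; [lra|split; [lra|]]. intros j Hj.
    destruct (le_lt_dec j m) as [Hm|Hm].
    + pose proof (spacing_mono _ _ Hm). split_abs; lra.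
    + pose proof (spacing_mono_S _ _ Hm). split_abs; lra.
Qed.

Lemma comb_above_floor (k : nat) (x y : R) :
  (k < 5 * N)%nat -> u * INR k <= x <= u * INR k + u ->
  0 <= comb_gap N (x, y) -> 0 <= edge_gap N k x y.
Proof.
  intros Hk Hx H. apply comb_gap_nonneg in H. destruct H as (H1 & H2 & H3 & H4 & H5).
  unfold edge_gap.
  pose proof spacing_pos as Hu. pose proof spacing_total as Ht.
  destruct (cell_cases k) as (m & [(E & Ek & -> & ->) | [(E & Ek & -> & ->) | (E & Ek & -> & ->)]]).
  - rewrite Ek in *. specialize (H5 m ltac:(lia)). split_abs; lra.
  - nra.
  (* The right wall of the last tooth belongs to the half spike at abscissa 1, which has an
     inequality of its own. *)
  - rewrite Ek in *. destruct (Nat.eq_dec (S m) N) as [En|En].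
    + assert (INR N = INR m + 1) as EN by (rewrite <- En; apply S_INR).
      rewrite EN in Ht. lra.
    + specialize (H5 (S m) ltac:(lia)). rewrite S_INR in H5. split_abs; lra.
Qed.

Lemma comb_of_floor (k : nat) (x y : R) :
  (k < 5 * N)%nat -> u * INR k <= x <= u * INR k + u ->
  0 <= x -> x + y <= 1 -> 0 <= edge_gap N k x y -> 0 <= comb_gap N (x, y).
Proof.
  intros Hk Hx H1 H2 H. destruct (cell_slack k x y Hk Hx) as (K1 & K2 & K3).
  pose proof spacing_pos. apply comb_gap_nonneg. repeat split; try nra.
  intros j Hj. specialize (K3 j Hj). lra.
Qed.

Lemma comb_of_floor_strict (k : nat) (x y : R) :
  (k < 5 * N)%nat -> u * INR k <= x <= u * INR k + u ->
  0 < x -> x + y < 1 -> 0 < edge_gap N k x y -> 0 < comb_gap N (x, y).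
Proof.
  intros Hk Hx H1 H2 H. destruct (cell_slack k x y Hk Hx) as (K1 & K2 & K3).
  pose proof spacing_pos. apply comb_gap_positive; try nra.
  intros j Hj. specialize (K3 j Hj). lra.
Qed.

(** * The vertex list and its edges *)

Lemma comb_verts_length : length (comb_verts N D i) = (5 * N + 2)%nat.
Proof. unfold comb_verts. now rewrite length_map, length_seq. Qed.

Lemma vtx_comb (k : nat) :
  vtx (comb_verts N D i) k = comb_vertex N D i (k mod (5 * N + 2)).
Proof.
  unfold vtx. rewrite comb_verts_length. unfold comb_verts.
  pose proof (Nat.mod_upper_bound k (5 * N + 2) ltac:(lia)).
  rewrite nth_indep with (d' := comb_vertex N D i 0) by now rewrite length_map, length_seq.
  rewrite map_nth, seq_nth by assumption. reflexivity.
Qed.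

Lemma vtx_comb_lt (k : nat) :
  (k < 5 * N + 2)%nat -> vtx (comb_verts N D i) k = comb_vertex N D i k.
Proof. intros H. now rewrite vtx_comb, Nat.mod_small. Qed.

(** The order of the tests matters for [i = N]: edge [5 * N + 1] must be recognized as the closing
    edge, and the other chamber indices are then out of range. *)
Definition edge_shape (k : nat) (z : point) : Prop :=
  if (k =? 5 * N + 1)%nat then fst z = 0 /\ 0 <= snd z <= 1
  else if (k =? 5 * N)%nat then fst z + snd z = 1 /\ 0 <= snd z <= 1
  else if (k =? 5 * i + 1)%nat then
    fst z = u * (5 * INR i + 1) + (snd z + 1) /\ - 1 - D <= snd z <= - 1
  else if (k =? 5 * i + 2)%nat then
    u * (5 * INR i + 1) - D <= fst z <= u * (5 * INR i + 4) + D /\ snd z = - 1 - D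
  else if (k =? 5 * i + 3)%nat then
    fst z = u * (5 * INR i + 4) - (snd z + 1) /\ - 1 - D <= snd z <= - 1
  else u * INR k <= fst z <= u * INR k + u /\ edge_gap N k (fst z) (snd z) = 0.

Lemma comb_vertex_plain (k : nat) :
  k <> (5 * N + 1)%nat -> k <> (5 * i + 2)%nat -> k <> (5 * i + 3)%nat ->
  comb_vertex N D i k = (u * INR k, rest_height k).
Proof.
  intros H1 H2 H3. unfold comb_vertex.
  apply Nat.eqb_neq in H1, H2, H3. now rewrite H1, H2, H3.
Qed.

Lemma comb_vertex_apex : comb_vertex N D i (5 * N + 1) = (0, 1).
Proof. unfold comb_vertex. now rewrite Nat.eqb_refl. Qed.

Lemma comb_vertex_left :
  (i < N)%nat -> comb_vertex N D i (5 * i + 2) = (u * (5 * INR i + 1) - D, - 1 - D).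
Proof.
  intros H. unfold comb_vertex. rewrite Nat.eqb_refl.
  destruct (Nat.eqb_spec (5 * i + 2) (5 * N + 1)); [lia|reflexivity].
Qed.

Lemma comb_vertex_right :
  (i < N)%nat -> comb_vertex N D i (5 * i + 3) = (u * (5 * INR i + 4) + D, - 1 - D).
Proof.
  intros H. unfold comb_vertex. rewrite Nat.eqb_refl.
  destruct (Nat.eqb_spec (5 * i + 3) (5 * N + 1)); [lia|].
  destruct (Nat.eqb_spec (5 * i + 3) (5 * i + 2)); [lia|reflexivity].
Qed.

Lemma rest_height_0 (j : nat) : rest_height (5 * j) = 0.
Proof. rewrite <- (Nat.add_0_r (5 * j)). now rewrite rest_height_block by lia. Qed.

Lemma INR_5 (j : nat) : INR (5 * j) = 5 * INR j.
Proof. rewrite mult_INR. simpl (INR 5). ring. Qed.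

Lemma edge_pt_shape (k : nat) (z : point) :
  (k < 5 * N + 2)%nat -> (edge_pt (comb_verts N D i) k z <-> edge_shape k z).
Proof.
  intros Hk. unfold edge_pt, edge_shape. rewrite (vtx_comb_lt k Hk).
  pose proof spacing_pos as Hu. pose proof spacing_total as Ht.
  destruct (Nat.eqb_spec k (5 * N + 1)) as [->|H1].
  { rewrite vtx_comb. replace (S (5 * N + 1)) with (5 * N + 2)%nat by lia.
    rewrite Nat.Div0.mod_same, comb_vertex_apex, comb_vertex_plain by lia.
    change (rest_height 0) with (if true then 0 else -1). simpl.
    split; intros H.
    - apply on_seg_sym, on_seg_snd in H; simpl in *; [|lra]. nra.
    - apply on_seg_sym, on_seg_snd; simpl in *; [lra|]. nra. }
  rewrite vtx_comb_lt by lia.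
  destruct (Nat.eqb_spec k (5 * N)) as [->|H2].
  { replace (S (5 * N)) with (5 * N + 1)%nat by lia.
    rewrite comb_vertex_apex, comb_vertex_plain by lia. rewrite rest_height_0, INR_5, Ht.
    split; intros H.
    - apply on_seg_snd in H; simpl in *; [|lra]. lra.
    - apply on_seg_snd; simpl in *; [lra|]. lra. }
  destruct (Nat.eqb_spec k (5 * i + 1)) as [->|H3].
  { replace (S (5 * i + 1)) with (5 * i + 2)%nat by lia.
    rewrite comb_vertex_left, comb_vertex_plain by lia.
    rewrite rest_height_block, INR_block by lia. simpl.
    split; intros H.
    - apply on_seg_sym, on_seg_snd in H; simpl in *; [|lra]. split; [|lra].
      destruct H as [Hy H]. apply (Rmult_eq_reg_r D); [|lra]. lra.
    - apply on_seg_sym, on_seg_snd; simpl in *; [lra|].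
      destruct H as [-> H]. split; [lra|]. ring. }
  destruct (Nat.eqb_spec k (5 * i + 2)) as [->|H4].
  { replace (S (5 * i + 2)) with (5 * i + 3)%nat by lia.
    rewrite comb_vertex_left, comb_vertex_right by lia.
    split; intros H.
    - apply on_seg_fst in H; simpl in *; [|lra]. destruct H as [Hx H]. split; [exact Hx|].
      apply (Rmult_eq_reg_r (u * (5 * INR i + 4) + D - (u * (5 * INR i + 1) - D))); lra.
    - apply on_seg_fst; simpl in *; [lra|]. destruct H as [Hx ->]. split; [exact Hx|ring]. }
  destruct (Nat.eqb_spec k (5 * i + 3)) as [->|H5].
  { replace (S (5 * i + 3)) with (5 * i + 4)%nat by lia.
    rewrite comb_vertex_right, comb_vertex_plain by lia.
    rewrite rest_height_block, INR_block by lia.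
    replace (INR 4) with 4 by (simpl; ring). simpl.
    split; intros H.
    - apply on_seg_snd in H; simpl in *; [|lra]. split; [|lra].
      destruct H as [Hy H]. apply (Rmult_eq_reg_r D); [|lra]. lra.
    - apply on_seg_snd; simpl in *; [lra|].
      destruct H as [-> H]. split; [lra|]. ring. }
  rewrite !comb_vertex_plain by lia. rewrite S_INR. unfold edge_gap.
  split; intros H.
  - apply on_seg_fst in H; simpl in *; [|lra]. lra.
  - apply on_seg_fst; simpl in *; [lra|]. lra.
Qed.

Lemma vertex_on_edge (k : nat) :
  (k < 5 * N + 2)%nat -> edge_shape k (comb_vertex N D i k).
Proof.
  intros Hk. apply edge_pt_shape; [exact Hk|]. unfold edge_pt.
  rewrite vtx_comb_lt by exact Hk. apply on_seg_l.
Qed.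

Lemma chain_shape (z : point) :
  chain (comb_verts N D i) z <-> exists k, (k < 5 * N + 2)%nat /\ edge_shape k z.
Proof.
  unfold chain. rewrite comb_verts_length.
  split; intros (k & Hk & K); exists k; (split; [exact Hk|]); now apply edge_pt_shape.
Qed.

Lemma floor_edge_bounds (k : nat) (x y : R) :
  u * INR k <= x <= u * INR k + u -> edge_gap N k x y = 0 -> - 1 <= y <= 0.
Proof.
  intros Hx. unfold edge_gap. pose proof spacing_pos as Hu.
  destruct (cell_cases k) as (m & [(E & Ek & -> & ->) | [(E & Ek & -> & ->) | (E & Ek & -> & ->)]]);
    intros H; split; apply (Rmult_le_reg_l u); lra.
Qed.

Lemma edge_gap_left (k : nat) (y : R) :
  edge_gap N k (u * INR k) y = 0 -> y = rest_height k.
Proof.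
  unfold edge_gap. pose proof spacing_pos as Hu. intros H.
  apply (Rmult_eq_reg_l u); lra.
Qed.

Lemma spacing_lt_inv (a b : nat) : u * INR a < u * INR b -> (a < b)%nat.
Proof.
  intros H. destruct (le_lt_dec b a) as [Hl|]; [|assumption].
  pose proof (spacing_mono _ _ Hl). lra.
Qed.

(* The open interval is the projection of the bottom of tooth [i]. *)
Lemma cell_of_bottom (k : nat) (x : R) :
  u * INR k <= x <= u * INR k + u -> u * (5 * INR i + 1) < x < u * (5 * INR i + 4) ->
  (k = 5 * i + 1 \/ k = 5 * i + 2 \/ k = 5 * i + 3)%nat.
Proof.
  intros Hk Hx.
  assert (5 * i + 1 < k + 1)%nat.
  { apply spacing_lt_inv. rewrite INR_block, plus_INR. simpl (INR 1). lra. }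
  assert (k < 5 * i + 4)%nat; [|lia].
  apply spacing_lt_inv. rewrite INR_block. replace (INR 4) with 4 by (simpl; ring). lra.
Qed.

(** Heights separate the edges of the room (at least 0), of the floor (between -1 and 0) and of the
    chamber (at most -1); two edges of different kinds can only touch at height 0 or -1. Within the
    floor, abscissas separate all but neighbouring cells. *)
Lemma edges_meet (k l : nat) (z : point) :
  (k < l)%nat -> (l < 5 * N + 2)%nat -> edge_shape k z -> edge_shape l z ->
  (l = S k /\ z = comb_vertex N D i l) \/
  (k = 0%nat /\ l = (5 * N + 1)%nat /\ z = comb_vertex N D i k).
Proof.
  intros Hkl Hl Hk Hz. pose proof spacing_pos as Hu. pose proof spacing_total as Ht.
  pose proof spacing_le as Hu5.
  destruct z as [x y]. unfold edge_shape in *; simpl fst in *; simpl snd in *.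
  destruct (Nat.eqb_spec k (5 * N + 1)) as [|_]; [lia|].
  destruct (Nat.eqb_spec l (5 * N + 1)) as [->|L1].
  { destruct (Nat.eqb_spec k (5 * N)) as [->|K2].
    { left. split; [lia|]. rewrite comb_vertex_apex. f_equal; lra. }
    destruct (Nat.eqb_spec k (5 * i + 1)); [lra|].
    destruct (Nat.eqb_spec k (5 * i + 2)); [lra|].
    destruct (Nat.eqb_spec k (5 * i + 3)); [lra|].
    destruct Hk as [Hx He]. pose proof (floor_edge_bounds _ _ _ Hx He).
    destruct k as [|k].
    - right. repeat split. rewrite comb_vertex_plain by lia.
      unfold rest_height; simpl. f_equal; lra.
    - pose proof (spacing_mono_S 0 (S k) ltac:(lia)) as K. simpl (INR 0) in K. lra. }
  destruct (Nat.eqb_spec k (5 * N)) as [|K2]; [lia|].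
  destruct (Nat.eqb_spec l (5 * N)) as [->|L2].
  { destruct (Nat.eqb_spec k (5 * i + 1)); [lra|].
    destruct (Nat.eqb_spec k (5 * i + 2)); [lra|].
    destruct (Nat.eqb_spec k (5 * i + 3)); [lra|].
    destruct Hk as [Hx He]. pose proof (floor_edge_bounds _ _ _ Hx He).
    destruct (Nat.eq_dec (S k) (5 * N)) as [E|E].
    - left. split; [lia|]. rewrite comb_vertex_plain by lia.
      rewrite rest_height_0, INR_5. f_equal; lra.
    - pose proof (spacing_mono_S (S k) (5 * N) ltac:(lia)) as K.
      rewrite S_INR, INR_5 in K. lra. }
  destruct (Nat.eqb_spec k (5 * i + 1)) as [->|K3];
    destruct (Nat.eqb_spec l (5 * i + 1)) as [->|L3]; try lia.
  { destruct (Nat.eqb_spec l (5 * i + 2)) as [->|L4].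
    - left. split; [lia|]. rewrite comb_vertex_left by lia. f_equal; lra.
    - destruct (Nat.eqb_spec l (5 * i + 3)) as [->|L5]; [lra|].
      destruct Hz as [Hx He]. pose proof (floor_edge_bounds _ _ _ Hx He).
      pose proof (spacing_mono (5 * i + 4) l ltac:(lia)) as K.
      rewrite INR_block in K. simpl (INR 4) in K. lra. }
  { destruct (Nat.eqb_spec k (5 * i + 2)); [lia|].
    destruct (Nat.eqb_spec k (5 * i + 3)); [lia|].
    destruct Hk as [Hx He]. pose proof (floor_edge_bounds _ _ _ Hx He).
    assert (k = 5 * i)%nat as ->.
    { assert (5 * i + 1 < k + 2)%nat; [|lia].
      apply spacing_lt_inv. rewrite INR_block, plus_INR. simpl (INR 1). simpl (INR 2). lra. }
    left. split; [lia|]. rewrite comb_vertex_plain by lia.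
    rewrite rest_height_block, INR_block by lia. simpl. f_equal; lra. }
  destruct (Nat.eqb_spec k (5 * i + 2)) as [->|K4];
    destruct (Nat.eqb_spec l (5 * i + 2)) as [->|L4]; try lia.
  { destruct (Nat.eqb_spec l (5 * i + 3)) as [->|L5].
    - left. split; [lia|]. rewrite comb_vertex_right by lia. f_equal; lra.
    - destruct Hz as [Hx He]. pose proof (floor_edge_bounds _ _ _ Hx He). lra. }
  { destruct (Nat.eqb_spec k (5 * i + 3)); [lia|].
    destruct Hk as [Hx He]. pose proof (floor_edge_bounds _ _ _ Hx He). lra. }
  destruct (Nat.eqb_spec k (5 * i + 3)) as [->|K5];
    destruct (Nat.eqb_spec l (5 * i + 3)) as [->|L5]; try lia.
  { destruct Hz as [Hx He]. pose proof (floor_edge_bounds _ _ _ Hx He).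
    assert (l = 5 * i + 4)%nat as ->.
    { assert (l < 5 * i + 5)%nat; [|lia].
      apply spacing_lt_inv. rewrite INR_block. simpl (INR 5). lra. }
    left. split; [lia|]. rewrite comb_vertex_plain by lia.
    rewrite rest_height_block, INR_block by lia.
    replace (INR 4) with 4 by (simpl; ring). simpl. f_equal; lra. }
  { destruct Hk as [Hx He]. pose proof (floor_edge_bounds _ _ _ Hx He).
    pose proof (spacing_mono (k + 1) (5 * i + 1) ltac:(lia)) as K.
    rewrite INR_block, plus_INR in K. simpl (INR 1) in K. lra. }
  destruct Hk as [Hkx Hke], Hz as [Hlx Hle].
  assert (l = S k) as ->.
  { assert (l < k + 2)%nat; [|lia].
    apply spacing_lt_inv. rewrite plus_INR. simpl (INR 2). lra. }
  left. split; [reflexivity|]. rewrite comb_vertex_plain by lia.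
  assert (x = u * INR (S k)) as Ex by (rewrite S_INR in *; lra).
  rewrite Ex in *. f_equal. now apply edge_gap_left.
Qed.

Lemma comb_simple_chain : simple_chain (comb_verts N D i).
Proof.
  split; rewrite comb_verts_length; [lia|].
  assert (forall k l z, (k < l)%nat -> (l < 5 * N + 2)%nat ->
    edge_pt (comb_verts N D i) k z -> edge_pt (comb_verts N D i) l z ->
    (l = (S k) mod (5 * N + 2) /\ z = vtx (comb_verts N D i) l) \/
    (k = (S l) mod (5 * N + 2) /\ z = vtx (comb_verts N D i) k)) as H.
  { intros k l z Hkl Hl Ek El.
    apply edge_pt_shape in Ek; [|lia]. apply edge_pt_shape in El; [|lia].
    destruct (edges_meet k l z Hkl Hl Ek El) as [[-> E]|(-> & -> & E)].
    - left. rewrite Nat.mod_small by lia. now rewrite vtx_comb_lt by lia.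
    - right. replace (S (5 * N + 1)) with (5 * N + 2)%nat by lia.
      rewrite Nat.Div0.mod_same. now rewrite vtx_comb_lt by lia. }
  intros k l Hk Hl Hkl z Ek El.
  destruct (Nat.lt_total k l) as [Hlt|[|Hlt]]; [now apply H|lia|].
  destruct (H l k z Hlt Hk El Ek); [now right|now left].
Qed.

(** * Signed area *)

Fixpoint cross_sum (f : nat -> point) (n : nat) : R :=
  match n with O => 0 | S m => cross_sum f m + cross (f m) (f (S m)) end.

Lemma area2_aux_cross_sum (f : nat -> point) (first : point) (n a : nat) :
  area2_aux (map f (seq a (S n))) first =
  cross_sum f (a + n) - cross_sum f a + cross (f (a + n)%nat) first.
Proof.
  revert a. induction n as [|n IH]; intros a.
  - simpl. rewrite Nat.add_0_r. ring.
  - change (area2_aux (map f (seq a (S (S n)))) first)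
      with (cross (f a) (f (S a)) + area2_aux (map f (seq (S a) (S n))) first).
    rewrite IH. rewrite <- Nat.add_succ_comm. simpl. ring.
Qed.

(** The sum is taken tooth by tooth, in blocks of five edges. The valleys are collinear with the
    origin, so a block contributes twice the area enclosed between the axis and its tooth, together
    with the chamber when there is one. *)
Lemma comb_cross_sum (j : nat) :
  (j <= N)%nat -> 0 <= cross_sum (comb_vertex N D i) (5 * j).
Proof.
  pose proof spacing_pos as Hu.
  induction j as [|j IH]; intros Hj; [simpl; lra|].
  specialize (IH ltac:(lia)).
  replace (5 * S j)%nat with (S (S (S (S (S (5 * j)))))) by lia.
  cbn [cross_sum].
  replace (S (S (S (S (S (5 * j)))))) with (5 * S j)%nat by lia.
  replace (S (S (S (S (5 * j))))) with (5 * j + 4)%nat by lia.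
  replace (S (S (S (5 * j)))) with (5 * j + 3)%nat by lia.
  replace (S (S (5 * j))) with (5 * j + 2)%nat by lia.
  replace (S (5 * j)) with (5 * j + 1)%nat by lia.
  rewrite (comb_vertex_plain (5 * j)), (comb_vertex_plain (5 * j + 1)),
    (comb_vertex_plain (5 * j + 4)), (comb_vertex_plain (5 * S j)) by lia.
  rewrite !rest_height_0, !rest_height_block, !INR_block, !INR_5, (S_INR j) by lia.
  replace (INR 4) with 4 by (simpl; ring). simpl (INR 1).
  destruct (Nat.eq_dec j i) as [->|Hji].
  - rewrite comb_vertex_left, comb_vertex_right by lia.
    unfold cross; simpl. set (s := cross_sum _ _) in *. clearbody s. nra.
  - rewrite (comb_vertex_plain (5 * j + 2)), (comb_vertex_plain (5 * j + 3)) by lia.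
    rewrite !rest_height_block, !INR_block by lia.
    replace (INR 3) with 3 by (simpl; ring). simpl (INR 2).
    unfold cross; simpl. set (s := cross_sum _ _) in *. clearbody s. nra.
Qed.

Lemma comb_area : 0 < area2 (comb_verts N D i).
Proof.
  pose proof (comb_cross_sum N ltac:(lia)) as H.
  pose proof spacing_total as Ht.
  unfold comb_verts. replace (5 * N + 2)%nat with (S (5 * N + 1)) by lia.
  change (area2 (map (comb_vertex N D i) (seq 0 (S (5 * N + 1)))))
    with (area2_aux (map (comb_vertex N D i) (seq 0 (S (5 * N + 1)))) (comb_vertex N D i 0)).
  rewrite area2_aux_cross_sum, Nat.add_0_l.
  replace (cross_sum (comb_vertex N D i) (5 * N + 1)) with
    (cross_sum (comb_vertex N D i) (5 * N) +
     cross (comb_vertex N D i (5 * N)) (comb_vertex N D i (5 * N + 1)))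
    by (rewrite Nat.add_1_r; reflexivity).
  rewrite comb_vertex_apex, (comb_vertex_plain (5 * N)), (comb_vertex_plain 0) by lia.
  rewrite rest_height_0, INR_5, Ht.
  set (s := cross_sum _ _) in *. clearbody s. unfold cross, rest_height; simpl. lra.
Qed.

Lemma room_in_comb (x y : R) :
  0 <= x -> 0 <= y -> x + y <= 1 -> 0 <= comb_gap N (x, y).
Proof.
  intros Hx Hy Hxy. pose proof spacing_pos as Hu. apply comb_gap_nonneg.
  repeat split; try nra.
  intros j _. pose proof (Rabs_pos (x - u * (5 * INR j))). nra.
Qed.

Lemma comb_abscissa (x y : R) : 0 <= comb_gap N (x, y) -> 0 <= x <= 1.
Proof.
  intros H. apply comb_gap_nonneg in H. pose proof spacing_pos. nra.
Qed.

Lemma comb_below_bottom (x y : R) : y < - 1 -> ~ 0 <= comb_gap N (x, y).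
Proof. intros H K. apply comb_gap_nonneg in K. lra. Qed.

Lemma comb_right_of_apex_edge (x y : R) : 1 < x + y -> ~ 0 <= comb_gap N (x, y).
Proof. intros H K. apply comb_gap_nonneg in K. lra. Qed.

Lemma comb_left_of_axis (x y : R) : x < 0 -> ~ 0 <= comb_gap N (x, y).
Proof. intros H K. apply comb_gap_nonneg in K. lra. Qed.

(** * The boundary of a comb with a chamber *)

Section Chamber.

Hypothesis Hlt : (i < N)%nat.

Lemma tooth_range : 0 <= u * (5 * INR i) /\ u * (5 * INR i + 5) <= 1.
Proof.
  pose proof (spacing_mono_S i N Hlt) as H. pose proof spacing_total as Ht.
  pose proof spacing_pos as Hu. pose proof (pos_INR i). 
  pose proof (spacing_mono (S i) N Hlt) as K. rewrite S_INR in K. split; nra.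
Qed.

Lemma bottom_cell (x : R) :
  u * (5 * INR i + 1) < x < u * (5 * INR i + 4) ->
  exists k, (k < 5 * N)%nat /\ u * INR k <= x <= u * INR k + u /\
    forall y, edge_gap N k x y = u * (y + 1).
Proof.
  intros Hx. pose proof spacing_pos as Hu. pose proof tooth_range as Hr.
  destruct (cell_exists x) as (k & Hk & Hkx); [nra|].
  exists k. split; [exact Hk|]. split; [exact Hkx|]. intros y. unfold edge_gap.
  destruct (cell_of_bottom k x Hkx Hx) as [-> | [-> | ->]];
    rewrite ?plus_n_Sm, !rest_height_block by lia; simpl; ring.
Qed.

Lemma comb_in_tooth (x y : R) :
  u * (5 * INR i + 1) < x < u * (5 * INR i + 4) -> - 1 < y -> x + y < 1 ->
  0 < comb_gap N (x, y).
Proof.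
  intros Hx Hy Hxy. pose proof spacing_pos as Hu. pose proof tooth_range as Hr.
  destruct (bottom_cell x Hx) as (k & Hk & Hkx & E).
  apply (comb_of_floor_strict k); rewrite ?E; try assumption; nra.
Qed.

(** Above height -1 only the tip where the prolonged walls meet is left, and it lies inside the
    tooth: above the bottom, the chamber adds nothing to the comb. *)
Lemma chamber_in_tooth (x y : R) :
  - 1 < y -> 0 <= chamber_gap N D i (x, y) -> 0 < comb_gap N (x, y).
Proof.
  intros Hy H. apply chamber_gap_nonneg in H. destruct H as [_ H].
  pose proof tooth_range as Hr. pose proof spacing_pos as Hu. pose proof spacing_le.
  apply comb_in_tooth; split_abs; lra.
Qed.

Lemma comb_left_of_bottom (s : R) :
  0 < s < u -> ~ 0 <= comb_gap N (u * (5 * INR i + 1) - s, - 1).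
Proof.
  intros Hs H. apply (comb_above_floor (5 * i)) in H; [|lia|rewrite INR_5; lra].
  unfold edge_gap in H. replace (S (5 * i)) with (5 * i + 1)%nat in H by lia.
  rewrite rest_height_0, rest_height_block, INR_5 in H by lia. simpl in H. lra.
Qed.

Lemma comb_right_of_bottom (s : R) :
  0 < s < u -> ~ 0 <= comb_gap N (u * (5 * INR i + 4) + s, - 1).
Proof.
  intros Hs H. apply (comb_above_floor (5 * i + 4)) in H;
    [|lia|rewrite INR_block; replace (INR 4) with 4 by (simpl; ring); lra].
  unfold edge_gap in H. replace (S (5 * i + 4)) with (5 * S i)%nat in H by lia.
  rewrite rest_height_0, rest_height_block, INR_block in H by lia.
  replace (INR 4) with 4 in H by (simpl; ring). simpl in H. lra.
Qed.

Lemma comb_region_gap (z : point) :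
  comb_region N D i z <-> 0 <= Rmax (comb_gap N z) (chamber_gap N D i z).
Proof.
  unfold comb_region, Rmax. destruct (Rle_dec (comb_gap N z) (chamber_gap N D i z)).
  - split; [intros [H|[_ H]]; lra|intros H; right; auto].
  - split; [intros [H|[_ H]]; lra|intros H; left; auto].
Qed.

Lemma interior_of_gap (z : point) :
  0 < comb_gap N z \/ 0 < chamber_gap N D i z -> interior (comb_region N D i) z.
Proof.
  intros H.
  destruct (gap_open (fun z => Rmax (comb_gap N z) (chamber_gap N D i z)) z) as (e & He & K).
  - apply continuous_gap_max; [apply wedge_gap_continuous|apply chamber_gap_continuous].
  - unfold Rmax. destruct (Rle_dec _ _); lra.
  - exists e. split; [exact He|]. intros y Hy. apply comb_region_gap. left. auto.
Qed.

Lemma chamber_gap_positive (x y : R) :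
  - 1 - D < y -> Rabs (x - u * (5 * INR i + 5 / 2)) < 3 / 2 * u - 1 - y ->
  0 < chamber_gap N D i (x, y).
Proof.
  intros H1 H2. unfold chamber_gap. rewrite Rmin_positive. simpl.
  replace (x + - (u * (5 * INR i + 5 / 2))) with (x - u * (5 * INR i + 5 / 2)) by ring.
  lra.
Qed.

(** At such a point neither gap is positive and one of them vanishes. The zero set of each gap has a
    part inside the other set that must be ruled out: the opening for the comb, the tip in the tooth
    for the chamber. *)
Lemma boundary_on_chain (z : point) :
  0 <= Rmax (comb_gap N z) (chamber_gap N D i z) ->
  ~ interior (comb_region N D i) z ->
  exists k, (k < 5 * N + 2)%nat /\ edge_shape k z.
Proof.
  intros H Hint.
  assert (~ 0 < comb_gap N z) as Hc by (intros K; apply Hint, interior_of_gap; now left).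
  assert (~ 0 < chamber_gap N D i z) as Hh by (intros K; apply Hint, interior_of_gap; now right).
  clear Hint. pose proof spacing_pos as Hu. pose proof spacing_total as Ht.
  pose proof tooth_range as Hr.
  assert (0 <= comb_gap N z \/ 0 <= chamber_gap N D i z) as [Hz|Hz]
    by (unfold Rmax in H; destruct (Rle_dec _ _); auto); clear H; destruct z as [x y].
  - pose proof (comb_abscissa x y Hz) as Hx.
    destruct (cell_exists x Hx) as (k & Hk & Hkx).
    pose proof (comb_above_floor k x y Hk Hkx Hz) as Hf.
    pose proof (proj1 (comb_gap_nonneg N x y) Hz) as (H1 & H2 & H3 & H4 & H5).
    destruct (Req_dec x 0) as [->|Hx0].
    { exists (5 * N + 1)%nat. split; [lia|]. unfold edge_shape. rewrite Nat.eqb_refl. simpl.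
      specialize (H5 0%nat ltac:(lia)). simpl in H5.
      replace (0 - u * (5 * 0)) with 0 in H5 by ring. rewrite Rabs_R0 in H5. nra. }
    destruct (Req_dec (x + y) 1) as [Hxy|Hxy].
    { exists (5 * N)%nat. split; [lia|]. unfold edge_shape. rewrite Nat.eqb_refl.
      destruct (Nat.eqb_spec (5 * N) (5 * N + 1)); [lia|]. simpl. nra. }
    assert (edge_gap N k x y = 0) as He.
    { apply NNPP. intros Hne. apply Hc, (comb_of_floor_strict k); lra || assumption. }
    pose proof (floor_edge_bounds k x y Hkx He) as Hy.
    destruct (classic (k = 5 * i + 1 \/ k = 5 * i + 2 \/ k = 5 * i + 3)%nat) as [Hki|Hki].
    + assert (y = - 1) as ->.
      { apply Rle_antisym; [|lra]. clear - He Hki Hu. unfold edge_gap in He.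
        destruct Hki as [-> | [-> | ->]]; rewrite ?plus_n_Sm, !rest_height_block in He by lia;
          simpl in He; nra. }
      assert (u * (5 * INR i + 1) <= x <= u * (5 * INR i + 4)) as Hxi.
      { destruct Hki as [-> | [-> | ->]]; rewrite INR_block in Hkx; simpl INR in Hkx; nra. }
      (* Strictly between these abscissas the point is in the opening, where the chamber gap is
         positive. *)
      assert (x = u * (5 * INR i + 1) \/ x = u * (5 * INR i + 4)) as [-> | ->].
      { apply NNPP. intros Hne. apply Hh, chamber_gap_positive; [lra|]. split_abs; lra. }
      * exists (5 * i)%nat. split; [lia|]. unfold edge_shape.
        destruct (Nat.eqb_spec (5 * i) (5 * N + 1)); [lia|].
        destruct (Nat.eqb_spec (5 * i) (5 * N)); [lia|].
        destruct (Nat.eqb_spec (5 * i) (5 * i + 1)); [lia|].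
        destruct (Nat.eqb_spec (5 * i) (5 * i + 2)); [lia|].
        destruct (Nat.eqb_spec (5 * i) (5 * i + 3)); [lia|].
        unfold edge_gap. replace (S (5 * i)) with (5 * i + 1)%nat by lia.
        rewrite rest_height_0, rest_height_block, INR_5 by lia. simpl. lra.
      * exists (5 * i + 4)%nat. split; [lia|]. unfold edge_shape.
        destruct (Nat.eqb_spec (5 * i + 4) (5 * N + 1)); [lia|].
        destruct (Nat.eqb_spec (5 * i + 4) (5 * N)); [lia|].
        destruct (Nat.eqb_spec (5 * i + 4) (5 * i + 1)); [lia|].
        destruct (Nat.eqb_spec (5 * i + 4) (5 * i + 2)); [lia|].
        destruct (Nat.eqb_spec (5 * i + 4) (5 * i + 3)); [lia|].
        unfold edge_gap. replace (S (5 * i + 4)) with (5 * S i)%nat by lia.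
        rewrite rest_height_0, rest_height_block, INR_block by lia.
        replace (INR 4) with 4 by (simpl; ring). simpl. lra.
    + exists k. split; [lia|]. unfold edge_shape.
      destruct (Nat.eqb_spec k (5 * N + 1)); [lia|].
      destruct (Nat.eqb_spec k (5 * N)); [lia|].
      destruct (Nat.eqb_spec k (5 * i + 1)); [tauto|].
      destruct (Nat.eqb_spec k (5 * i + 2)); [tauto|].
      destruct (Nat.eqb_spec k (5 * i + 3)); [tauto|]. now split.
  - pose proof (proj1 (chamber_gap_nonneg N D i x y) Hz) as [H1 H2].
    destruct (Req_dec y (- 1 - D)) as [->|Hy].
    { exists (5 * i + 2)%nat. split; [lia|]. unfold edge_shape. rewrite Nat.eqb_refl.
      destruct (Nat.eqb_spec (5 * i + 2) (5 * N + 1)); [lia|].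
      destruct (Nat.eqb_spec (5 * i + 2) (5 * N)); [lia|].
      destruct (Nat.eqb_spec (5 * i + 2) (5 * i + 1)); [lia|]. simpl. split_abs; lra. }
    assert (Rabs (x - u * (5 * INR i + 5 / 2)) = 3 / 2 * u - 1 - y) as E.
    { apply NNPP. intros Hne. apply Hh, chamber_gap_positive; lra. }
    destruct (Rle_or_lt y (- 1)) as [Hy1|Hy1].
    2:{ exfalso. apply Hc, chamber_in_tooth; assumption. }
    destruct (Rle_or_lt x (u * (5 * INR i + 5 / 2))) as [Hx|Hx].
    + exists (5 * i + 1)%nat. split; [lia|]. unfold edge_shape. rewrite Nat.eqb_refl.
      destruct (Nat.eqb_spec (5 * i + 1) (5 * N + 1)); [lia|].
      destruct (Nat.eqb_spec (5 * i + 1) (5 * N)); [lia|]. simpl. split_abs; lra.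
    + exists (5 * i + 3)%nat. split; [lia|]. unfold edge_shape. rewrite Nat.eqb_refl.
      destruct (Nat.eqb_spec (5 * i + 3) (5 * N + 1)); [lia|].
      destruct (Nat.eqb_spec (5 * i + 3) (5 * N)); [lia|].
      destruct (Nat.eqb_spec (5 * i + 3) (5 * i + 1)); [lia|].
      destruct (Nat.eqb_spec (5 * i + 3) (5 * i + 2)); [lia|]. simpl. split_abs; lra.
Qed.

Lemma outside_region (x y : R) :
  ~ 0 <= comb_gap N (x, y) ->
  (- 1 - D <= y -> 3 / 2 * u - 1 - y < Rabs (x - u * (5 * INR i + 5 / 2))) ->
  ~ comb_region N D i (x, y).
Proof.
  intros H1 H2 [K|[_ K]]; [auto|]. apply chamber_gap_nonneg in K.
  destruct K as [K1 K2]. specialize (H2 K1). lra.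
Qed.

(** Next to every edge there is rock arbitrarily close, straight down, to the left or to the right,
    so these three directions suffice. *)
Lemma chain_not_interior (k : nat) (z : point) :
  (k < 5 * N + 2)%nat -> edge_shape k z -> ~ interior (comb_region N D i) z.
Proof.
  intros Hk Hz (e & He & K). pose proof spacing_pos as Hu. pose proof tooth_range as Hr.
  pose proof spacing_le as Hu5.
  destruct z as [x y].
  assert (forall M, 0 < M -> exists s, 0 < s < e /\ s < M) as Hsmall.
  { intros M HM. exists (Rmin e M / 2).
    pose proof (Rmin_glb_lt e M 0 He HM). pose proof (Rmin_l e M). pose proof (Rmin_r e M). lra. }
  assert (forall s, 0 < s < e -> comb_region N D i (x, y - s)) as Kd.
  { intros s Hs. apply K. rewrite dist_vertical. split_abs; lra. }
  assert (forall s, 0 < s < e -> comb_region N D i (x - s, y)) as Kl.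
  { intros s Hs. apply K. rewrite dist_horizontal. split_abs; lra. }
  assert (forall s, 0 < s < e -> comb_region N D i (x + s, y)) as Kr.
  { intros s Hs. apply K. rewrite dist_horizontal. split_abs; lra. }
  clear K. unfold edge_shape in Hz. simpl fst in Hz. simpl snd in Hz.
  destruct (Nat.eqb_spec k (5 * N + 1)) as [->|K1].
  { destruct (Hsmall 1 ltac:(lra)) as (s & Hs & _).
    apply (outside_region (x - s) y); [apply comb_left_of_axis; lra| |now apply Kl].
    intros _. pose proof (Rabs_pos (x - s - u * (5 * INR i + 5 / 2))). lra. }
  destruct (Nat.eqb_spec k (5 * N)) as [->|K2].
  { destruct (Hsmall 1 ltac:(lra)) as (s & Hs & _).
    apply (outside_region (x + s) y); [apply comb_right_of_apex_edge; lra| |now apply Kr].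
    intros _. pose proof (Rabs_pos (x + s - u * (5 * INR i + 5 / 2))). lra. }
  destruct (Hsmall u Hu) as (s & Hs & Hsu).
  assert (x = u * (5 * INR i + 1) + (y + 1) -> y <= - 1 -> False) as Hleft.
  { intros Hx Hy. apply (outside_region (x - s) y); [| |now apply Kl].
    - destruct (Req_dec y (- 1)) as [->|Hy1]; [|apply comb_below_bottom; lra].
      rewrite Hx. replace (- 1 + 1) with 0 by ring. rewrite Rplus_0_r.
      apply comb_left_of_bottom; lra.
    - intros _. split_abs; lra. }
  assert (x = u * (5 * INR i + 4) - (y + 1) -> y <= - 1 -> False) as Hright.
  { intros Hx Hy. apply (outside_region (x + s) y); [| |now apply Kr].
    - destruct (Req_dec y (- 1)) as [->|Hy1]; [|apply comb_below_bottom; lra].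
      rewrite Hx. replace (- 1 + 1) with 0 by ring. rewrite Rminus_0_r.
      apply comb_right_of_bottom; lra.
    - intros _. split_abs; lra. }
  destruct (Nat.eqb_spec k (5 * i + 1)) as [->|K3]; [apply Hleft; lra|].
  destruct (Nat.eqb_spec k (5 * i + 2)) as [->|K4].
  { apply (outside_region x (y - s)); [apply comb_below_bottom; lra|lra|now apply Kd]. }
  destruct (Nat.eqb_spec k (5 * i + 3)) as [->|K5]; [apply Hright; lra|].
  destruct Hz as [Hx Hf]. pose proof (floor_edge_bounds k x y Hx Hf) as Hy.
  assert (~ u * (5 * INR i + 1) < x < u * (5 * INR i + 4)) as Hout.
  { intros Hin. destruct (cell_of_bottom k x Hx Hin) as [|[|]]; congruence. }
  destruct (Req_dec y (- 1)) as [->|Hy1].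
  - destruct (Req_dec x (u * (5 * INR i + 1))) as [Ex|Ex]; [apply Hleft; lra|].
    destruct (Req_dec x (u * (5 * INR i + 4))) as [Ex'|Ex']; [apply Hright; lra|].
    assert (3 / 2 * u < Rabs (x - u * (5 * INR i + 5 / 2))) as Hfar.
    { split_abs; lra. }
    (* At [r] below the bottom the chamber has widened by [r] on each side; a step smaller than the
       distance from [x] to the opening stays in rock. *)
    destruct (Hsmall (Rabs (x - u * (5 * INR i + 5 / 2)) - 3 / 2 * u)) as (r & Hr1 & Hr2); [lra|].
    apply (outside_region x (- 1 - r)); [apply comb_below_bottom; lra|lra|now apply Kd].
  - destruct (Hsmall (y + 1)) as (r & Hr1 & Hr2); [lra|].
    apply (outside_region x (y - r)); [| |now apply Kd].
    + intros H. apply (comb_above_floor k) in H; [|lia|exact Hx].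
      unfold edge_gap in *. nra.
    + intros _. split_abs; lra.
Qed.

End Chamber.

Lemma chain_in_region (k : nat) (z : point) :
  (k < 5 * N + 2)%nat -> edge_shape k z -> comb_region N D i z.
Proof.
  intros Hk Hz. pose proof spacing_pos as Hu. pose proof spacing_total as Ht.
  destruct z as [x y]. unfold edge_shape in Hz. simpl fst in Hz. simpl snd in Hz.
  destruct (Nat.eqb_spec k (5 * N + 1)) as [->|K1]; [left; apply room_in_comb; lra|].
  destruct (Nat.eqb_spec k (5 * N)) as [->|K2]; [left; apply room_in_comb; lra|].
  destruct (Nat.eqb_spec k (5 * i + 1)) as [->|K3].
  { right. split; [lia|]. apply chamber_gap_nonneg. split_abs; lra. }
  destruct (Nat.eqb_spec k (5 * i + 2)) as [->|K4].
  { right. split; [lia|]. apply chamber_gap_nonneg. split_abs; lra. }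
  destruct (Nat.eqb_spec k (5 * i + 3)) as [->|K5].
  { right. split; [lia|]. apply chamber_gap_nonneg. split_abs; lra. }
  destruct Hz as [Hx Hf]. pose proof (floor_edge_bounds k x y Hx Hf) as Hy. left.
  pose proof (spacing_mono_S k (5 * N) ltac:(lia)) as H1. rewrite INR_5, Ht in H1.
  pose proof (pos_INR k). 
  apply (comb_of_floor k); try lra; try lia; nra.
Qed.

Lemma comb_region_closed : closed (comb_region N D i).
Proof.
  destruct (Nat.eq_dec i N) as [->|Hne].
  - apply (gap_closed (comb_gap N)); [apply wedge_gap_continuous|].
    intros z. unfold comb_region. split; [intros [H|[H _]]; [exact H|lia]|now left].
  - apply (gap_closed (fun z => Rmax (comb_gap N z) (chamber_gap N D i z))).
    + apply continuous_gap_max; [apply wedge_gap_continuous|apply chamber_gap_continuous].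
    + intros z. apply comb_region_gap. lia.
Qed.

Lemma comb_region_box (x y : R) :
  comb_region N D i (x, y) -> Rabs x <= D + 3 /\ Rabs y <= D + 1.
Proof.
  pose proof spacing_pos as Hu. pose proof spacing_le as Hu5.
  intros [H|[Hlt H]].
  - pose proof (comb_abscissa x y H). apply comb_gap_nonneg in H. split_abs; lra.
  - pose proof (tooth_range Hlt). apply chamber_gap_nonneg in H. split_abs; lra.
Qed.

Lemma comb_region_bounded : bounded (comb_region N D i).
Proof.
  exists (D + 3 + (D + 1)). intros [x y] H. apply comb_region_box in H.
  eapply Rle_trans; [apply dist_le_abs|]. simpl. rewrite !Rminus_0_l, !Rabs_Ropp. lra.
Qed.

Lemma comb_is_polygon :
  (i < N)%nat -> is_polygon (comb_verts N D i) (comb_region N D i).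
Proof.
  intros Hlt. split; [apply comb_simple_chain|]. split; [apply comb_area|].
  split; [apply comb_region_closed|]. split; [apply comb_region_bounded|]. split.
  - exists (u * (5 * INR i + 5 / 2), - 2). apply interior_of_gap; [exact Hlt|right].
    apply chamber_gap_positive; [lra|]. pose proof spacing_pos. split_abs; lra.
  - intros z. rewrite chain_shape. split.
    + intros [Hc Hi']. apply boundary_on_chain; [exact Hlt| |exact Hi'].
      apply comb_region_gap; [exact Hlt|]. now apply comb_region_closed.
    + intros (k & Hk & Hz). split.
      * apply closure_incl. now apply (chain_in_region k).
      * now apply (chain_not_interior Hlt k).
Qed.

(** The segment from the apex of the room to the lower right corner of the chamber has its midpoint
    in the rock to the right of the chamber. *)
Lemma comb_not_convex : (i < N)%nat -> ~ convex (comb_region N D i).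
Proof.
  intros Hlt H. pose proof (tooth_range Hlt) as Hr. pose proof spacing_pos as Hu.
  assert (comb_region N D i (0, 1)) as H0 by (left; apply room_in_comb; lra).
  assert (comb_region N D i (u * (5 * INR i + 4) + D, - 1 - D)) as H1.
  { rewrite <- comb_vertex_right by exact Hlt. apply (chain_in_region (5 * i + 3)); [lia|].
    apply vertex_on_edge. lia. }
  specialize (H _ _ (1 / 2) H0 H1 ltac:(lra)). revert H.
  unfold lerp, padd, pscale, psub; simpl fst; simpl snd.
  apply outside_region; [apply comb_below_bottom; lra|].
  intros _. split_abs; lra.
Qed.

(** * The treasure and a path to it *)

Section Configuration.

Variable a : R.
Hypothesis Ha : 8 <= a.
Hypothesis HDa : D = a + 1.
Hypothesis Hlt : (i < N)%nat.

(** With [D = a + 1] the floor of the chamber is 2 below the treasure, and at that depth the slanted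
    walls are far away, so crude bounds on the two coordinates suffice. *)
Lemma treasure_disc (z : point) :
  dist (u * (5 * INR i + 5 / 2), - a) z < 1 -> 0 < chamber_gap N D i z.
Proof.
  intros H. destruct z as [x y].
  pose proof (dist_fst (u * (5 * INR i + 5 / 2), - a) (x, y)) as Hx.
  pose proof (dist_snd (u * (5 * INR i + 5 / 2), - a) (x, y)) as Hy.
  simpl in *. pose proof spacing_pos. apply chamber_gap_positive; split_abs; lra.
Qed.

Lemma path_to_treasure :
  poly_in (comb_region N D i) (0, 1)
    ((u * (5 * INR i + 5 / 2), 0) :: (u * (5 * INR i + 5 / 2), - a) :: nil).
Proof.
  pose proof (tooth_range Hlt) as Hr. pose proof spacing_pos as Hu.
  simpl. split; [|split; [|exact I]]; intros z (t & Ht & ->); unfold lerp, padd, pscale, psub;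
    simpl fst; simpl snd.
  - left. apply room_in_comb; nra.
  - replace (u * (5 * INR i + 5 / 2) + t * (u * (5 * INR i + 5 / 2) - u * (5 * INR i + 5 / 2)))
      with (u * (5 * INR i + 5 / 2)) by ring.
    replace (0 + t * (- a - 0)) with (- (t * a)) by ring.
    assert (0 <= t * a <= a) by nra.
    destruct (Rlt_le_dec (- 1) (- (t * a))).
    + left. left. apply (comb_in_tooth Hlt); lra.
    + right. split; [exact Hlt|]. apply chamber_gap_nonneg. split_abs; lra.
Qed.

End Configuration.

End Comb.

(** * Geodesic distance and accessibility *)

Lemma poly_len_snd (b : point) (ws : list point) (a : point) :
  Rabs (snd a - snd b) <= poly_len a (ws ++ b :: nil).
Proof.
  revert a. induction ws as [|w ws IH]; intros a; simpl.
  - rewrite Rplus_0_r. apply dist_snd.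
  - pose proof (dist_snd a w). specialize (IH w). split_abs; lra.
Qed.

(** The choice operator in [geodist] means something only if an infimum exists; completeness is
    applied to the set of opposites. *)
Lemma geodist_bounds (c : config) (lo hi : R) :
  (forall l, path_length (region c) (start c) (treasure c) l -> lo <= l) ->
  path_length (region c) (start c) (treasure c) hi -> lo <= geodist c <= hi.
Proof.
  intros Hlo Hhi. set (E := path_length (region c) (start c) (treasure c)) in *.
  assert (is_inf E (geodist c)) as [H1 H2].
  { unfold geodist. apply epsilon_spec.
    destruct (completeness (fun x => E (- x))) as [m [Hub Hlub]].
    - exists (- lo). intros x Hx. specialize (Hlo _ Hx). lra.
    - exists (- hi). now rewrite Ropp_involutive.
    - exists (- m). split.
      + intros x Hx. specialize (Hub (- x)). simpl in Hub.
        rewrite Ropp_involutive in Hub. specialize (Hub Hx). lra.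
      + intros m' Hm'. assert (m <= - m'); [|lra].
        apply Hlub. intros x Hx. specialize (Hm' _ Hx). lra. }
  split; [now apply H2|now apply H1].
Qed.

Lemma accessibility_one (c : config) :
  bounded (region c) -> disc_in (region c) (treasure c) 1 -> accessibility c = 1.
Proof.
  intros [M HM] H1. set (q := treasure c) in *.
  assert (is_sup (disc_in (region c) q) (rho c)) as [Hub _].
  { unfold rho. apply epsilon_spec.
    destruct (completeness (disc_in (region c) q)) as [m [Hub Hlub]].
    - exists (Rabs (fst q) + M + 1). intros r [Hr K].
      apply Rnot_lt_le. intros Hlt.
      assert (0 <= M).
      { eapply Rle_trans; [apply dist_pos|]. apply HM, H1. unfold q. rewrite dist_refl. lra. }
      pose proof (Rabs_pos (fst q)).
      (* This point is in a disc of radius [r] around [q], but its abscissa is at least [M + 1], too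
         far for the bounded region. So the radii have a supremum, which is what [rho] selects. *)
      assert (region c (fst q + (Rabs (fst q) + M + 1), snd q)) as Hz.
      { apply K. destruct q as [q1 q2]. simpl in *. rewrite dist_horizontal. split_abs; lra. }
      specialize (HM _ Hz).
      pose proof (dist_fst (0, 0) (fst q + (Rabs (fst q) + M + 1), snd q)). simpl in *.
      split_abs; lra.
    - now exists 1.
    - exists m. now split. }
  unfold accessibility. apply Rmin_left. now apply Hub.
Qed.

Definition comb_config (A N i : nat) : config :=
  Config (comb_verts N (INR A + 1) i) (comb_region N (INR A + 1) i) (0, 1)
    (spacing N * (5 * INR i + 5 / 2), - INR A).

(** For a fixed [A] every positive [N] occurs, so [N] can be adapted to the constant and to the
    number of advice strings. *)
Definition comb_class (A : nat) (c : config) : Prop :=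
  exists N i, (i < N)%nat /\ c = comb_config A N i.

(** The drop from height 1 to height [-A] gives the lower bound. For the upper one, the path goes to
    the point of the axis above the middle of the tooth, at cost at most 2, and then straight
    down. *)
Lemma comb_geodist (A N i : nat) :
  (8 < A)%nat -> (i < N)%nat -> INR A + 1 <= geodist (comb_config A N i) <= INR A + 2.
Proof.
  intros HA Hi. assert (9 <= INR A) as H9.
  { apply le_INR in HA. simpl in HA. lra. }
  assert (0 < N)%nat as HN by lia.
  pose proof (tooth_range N i HN Hi) as Hr. pose proof (spacing_pos N HN) as Hu.
  set (hi := poly_len (0, 1) ((spacing N * (5 * INR i + 5 / 2), 0) ::
               (spacing N * (5 * INR i + 5 / 2), - INR A) :: nil)).
  assert (INR A + 1 <= geodist (comb_config A N i) <= hi) as H.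
  { apply geodist_bounds.
    - intros l (ws & _ & ->). eapply Rle_trans; [|apply poly_len_snd]. simpl. split_abs; lra.
    - exists ((spacing N * (5 * INR i + 5 / 2), 0) :: nil). split; [|reflexivity].
      apply path_to_treasure with (D := INR A + 1); lra || lia || reflexivity. }
  split; [apply H|]. eapply Rle_trans; [apply H|]. unfold hi. simpl.
  rewrite dist_vertical.
  pose proof (dist_le_abs (0, 1) (spacing N * (5 * INR i + 5 / 2), 0)) as K. simpl in K.
  assert (Rabs (0 - spacing N * (5 * INR i + 5 / 2)) <= 1) by (split_abs; lra).
  split_abs; lra.
Qed.

Lemma comb_class_spec (A : nat) (c : config) :
  (8 < A)%nat -> comb_class A c ->
  is_config c /\ ~ convex (region c) /\
  INR A / 2 < geodist c < 5 * INR A / 2 /\ accessibility c = 1.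
Proof.
  intros HA (N & i & Hi & ->). assert (9 <= INR A) as H9.
  { apply le_INR in HA. simpl in HA. lra. }
  assert (0 < N)%nat as HN by lia.
  pose proof (comb_geodist A N i HA Hi) as Hg.
  assert (forall z, dist (spacing N * (5 * INR i + 5 / 2), - INR A) z < 1 ->
            interior (comb_region N (INR A + 1) i) z) as Hdisc.
  { intros z Hz. apply interior_of_gap; [exact Hi|right].
    apply treasure_disc with (a := INR A); lra || lia || assumption. }
  split; [|split; [|split; [lra|]]].
  - split; [|split].
    + apply comb_is_polygon; lra || lia.
    + left. apply room_in_comb; lra || lia.
    + apply Hdisc. simpl. rewrite dist_refl. lra.
  - apply comb_not_convex; lra || lia.
  - apply accessibility_one.
    + apply comb_region_bounded; lra || lia.
    + split; [lra|]. intros z Hz. now apply interior_incl, Hdisc.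
Qed.

(** * Runs in combs with and without the chamber *)

(** The chamber prolonged downwards without a floor. It is closed and contains the bottom of tooth
    [i], so in the reference comb entering the cone means touching that bottom. *)
Definition cone (N i : nat) : pset := fun z =>
  snd z <= - 1 /\
  Rabs (fst z - spacing N * (5 * INR i + 5 / 2)) <= 3 / 2 * spacing N - 1 - snd z.

Lemma cone_closed (N i : nat) : closed (cone N i).
Proof.
  apply (gap_closed (fun z => Rmin (- 1 * snd z + - 1)
    (- 1 * snd z + (3 / 2 * spacing N - 1)
     + - 1 * Rabs (fst z + - (spacing N * (5 * INR i + 5 / 2)))))).
  - repeat first
    [ apply continuous_gap_min | apply continuous_gap_plus | apply continuous_gap_scal
    | apply continuous_gap_abs | apply continuous_gap_fst | apply continuous_gap_snd
    | apply continuous_gap_const ].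
  - intros z. unfold cone. rewrite Rmin_nonneg.
    change (fst z + - (spacing N * (5 * INR i + 5 / 2)))
      with (fst z - spacing N * (5 * INR i + 5 / 2)). lra.
Qed.

Lemma reference_region (A N : nat) (z : point) :
  region (comb_config A N N) z <-> 0 <= comb_gap N z.
Proof. simpl. unfold comb_region. split; [intros [H|[H _]]; [exact H|lia]|now left]. Qed.

Section Indistinguishable.

Variables (A N i : nat).
Hypothesis HA : (8 < A)%nat.
Hypothesis Hi : (i < N)%nat.

Local Notation reference := (comb_config A N N).
Local Notation actual := (comb_config A N i).

Lemma depth_ge : 8 <= INR A + 1.
Proof. apply le_INR in HA. simpl in HA. lra. Qed.

Lemma comb_nonempty : (0 < N)%nat.
Proof. lia. Qed.

Lemma reference_sub (z : point) : region reference z -> region actual z.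
Proof. intros H. left. now apply (reference_region A). Qed.

Lemma actual_off_cone (z : point) : ~ cone N i z -> region actual z -> region reference z.
Proof.
  intros Hn [H|[_ H]]; apply (reference_region A); [exact H|]. destruct z as [x y].
  assert (- 1 < y) as Hy.
  { apply Rnot_le_lt. intros Hy. apply Hn. apply chamber_gap_nonneg in H. now split. }
  left. apply (chamber_in_tooth N (INR A + 1) i); lia || assumption.
Qed.

(** For [m = i] these edges are the walls and floor of the chamber, for [m = N] the three pieces of
    the flat bottom that they replace. *)
Lemma modified_edge_in_cone (m k : nat) (z : point) :
  (m = i \/ m = N) -> (k = 5 * i + 1 \/ k = 5 * i + 2 \/ k = 5 * i + 3)%nat ->
  edge_pt (comb_verts N (INR A + 1) m) k z -> cone N i z.
Proof.
  intros Hm Hk Hz. pose proof depth_ge as HD. pose proof (spacing_pos N comb_nonempty) as Hu.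
  apply edge_pt_shape in Hz; [|exact comb_nonempty|lra|lia|lia].
  unfold edge_shape in Hz. unfold cone.
  destruct (Nat.eqb_spec k (5 * N + 1)); [lia|].
  destruct (Nat.eqb_spec k (5 * N)); [lia|].
  destruct Hm as [-> | ->].
  - destruct (Nat.eqb_spec k (5 * i + 1)); [split_abs; lra|].
    destruct (Nat.eqb_spec k (5 * i + 2)); [split_abs; lra|].
    destruct (Nat.eqb_spec k (5 * i + 3)); [split_abs; lra|lia].
  - destruct (Nat.eqb_spec k (5 * N + 1)); [lia|].
    destruct (Nat.eqb_spec k (5 * N + 2)); [lia|].
    destruct (Nat.eqb_spec k (5 * N + 3)); [lia|].
    unfold edge_gap in Hz.
    assert (snd z = - 1) as Ey.
    { destruct Hz as [_ Hz].
      destruct Hk as [-> | [-> | ->]]; rewrite ?plus_n_Sm, !rest_height_block in Hz by lia;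
        simpl in Hz; apply (Rmult_eq_reg_l (spacing N)); lra. }
    rewrite Ey. destruct Hz as [Hz _].
    destruct Hk as [-> | [-> | ->]]; rewrite INR_block in Hz; simpl INR in Hz; split_abs; lra.
Qed.

Lemma vtx_agree (k : nat) :
  (k <= 5 * N + 2)%nat -> k <> (5 * i + 2)%nat -> k <> (5 * i + 3)%nat ->
  vtx (comb_verts N (INR A + 1) i) k = vtx (comb_verts N (INR A + 1) N) k.
Proof.
  intros Hk H2 H3. rewrite !vtx_comb by lia.
  assert (forall l, (l < 5 * N + 2)%nat -> l <> (5 * i + 2)%nat -> l <> (5 * i + 3)%nat ->
    comb_vertex N (INR A + 1) i l = comb_vertex N (INR A + 1) N l) as E.
  { intros l Hl L2 L3. unfold comb_vertex.
    destruct (Nat.eqb_spec l (5 * i + 2)); [lia|].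
    destruct (Nat.eqb_spec l (5 * i + 3)); [lia|].
    destruct (Nat.eqb_spec l (5 * N + 2)); [lia|].
    destruct (Nat.eqb_spec l (5 * N + 3)); [lia|]. reflexivity. }
  destruct (Nat.eq_dec k (5 * N + 2)) as [->|].
  - rewrite Nat.Div0.mod_same. apply E; lia.
  - rewrite Nat.mod_small by lia. apply E; lia.
Qed.

(** A free move is controlled by its end point, through containment of the regions. A boundary move
    is controlled by its starting point, which lies on none of the modified edges. *)
Lemma exec_agree (x : point) (ins : instr) :
  ~ cone N i x -> ~ cone N i (fst (exec reference x ins)) ->
  exec actual x ins = exec reference x ins.
Proof.
  intros Hx. destruct ins as [v|o d].
  - simpl. intros Hy.
    now rewrite (free_param_agree _ _ (cone N i) (cone_closed N i) reference_sub actual_off_cone).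
  - intros _. unfold exec.
    rewrite (bnd_target_agree (verts actual) (verts reference)); [reflexivity| |].
    + simpl. now rewrite !comb_verts_length.
    + simpl. rewrite comb_verts_length. intros k Hk.
      destruct (classic (k = 5 * i + 1 \/ k = 5 * i + 2 \/ k = 5 * i + 3)%nat) as [Hm|Hm].
      * right. split; intros H; apply Hx;
          [apply (modified_edge_in_cone i k)|apply (modified_edge_in_cone N k)]; auto.
      * left. split; apply vtx_agree; lia.
Qed.

Lemma touching_agree (x : point) :
  ~ cone N i x -> touching_b actual x = touching_b reference x.
Proof.
  intros Hx. unfold touching_b.
  pose proof (boundary_agree _ _ _ (cone_closed N i) reference_sub actual_off_cone x Hx) as H.
  destruct (excluded_middle_informative (boundary (region actual) x));
    destruct (excluded_middle_informative (boundary (region reference) x)); simpl; tauto.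
Qed.

(** Only the simulated run is assumed to avoid the cone. Equal positions and observations so far
    make the algorithm issue the same instruction, which has the same effect in both combs. *)
Lemma run_agree (alg : algorithm) (adv : list bool) (k : nat) :
  (forall k', (k' <= k)%nat -> ~ cone N i (waypoint alg adv reference k')) ->
  run alg adv actual k = run alg adv reference k.
Proof.
  induction k as [|k IH]; intros H; [reflexivity|].
  assert (run alg adv actual k = run alg adv reference k) as E by (apply IH; intros; apply H; lia).
  pose proof (H k ltac:(lia)) as Hk. pose proof (H (S k) ltac:(lia)) as HSk.
  unfold waypoint in Hk, HSk. cbn [run] in *. rewrite E.
  destruct (run alg adv reference k) as [x h]. cbn [fst] in Hk.
  pose proof (exec_agree x (alg adv h) Hk) as Ex.
  destruct (exec reference x (alg adv h)) as [y f]. cbn [fst] in *.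
  rewrite Ex by exact HSk. now rewrite touching_agree by exact HSk.
Qed.

Lemma travelled_agree (alg : algorithm) (adv : list bool) (k : nat) :
  (forall k', (k' <= k)%nat -> ~ cone N i (waypoint alg adv reference k')) ->
  travelled alg adv actual k = travelled alg adv reference k.
Proof.
  induction k as [|k IH]; intros H; [reflexivity|]. cbn [travelled].
  rewrite IH by (intros; apply H; lia).
  unfold waypoint at 1 2. now rewrite !run_agree by (intros; apply H; lia).
Qed.

End Indistinguishable.

(** * Each visited tooth costs at least one *)

Section TeethAreCostly.

Variables (N : nat) (w : nat -> point) (trav : nat -> R).
Hypothesis HN : (0 < N)%nat.
Hypothesis Hseg : forall k, seg_in (fun z => 0 <= comb_gap N z) (w k) (w (S k)).
Hypothesis Hstart : 0 <= snd (w 0%nat).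
Hypothesis Htrav0 : trav 0%nat = 0.
Hypothesis HtravS : forall k, trav (S k) = trav k + dist (w k) (w (S k)).

Definition in_tooth (j : nat) (z : point) : Prop :=
  snd z < 0 /\ spacing N * (5 * INR j) < fst z < spacing N * (5 * INR j + 5).

Lemma in_tooth_unique (j l : nat) (z : point) : in_tooth j z -> in_tooth l z -> j = l.
Proof.
  intros [_ Hj] [_ Hl]. pose proof (spacing_pos N HN).
  destruct (Nat.lt_total j l) as [H1|[|H1]]; [exfalso|assumption|exfalso];
    apply (spacing_mono_S N HN) in H1; lra.
Qed.

Lemma cone_in_tooth (j : nat) (z : point) :
  0 <= comb_gap N z -> cone N j z -> snd z = - 1 /\ in_tooth j z.
Proof.
  destruct z as [x y]. intros H [H1 H2]. simpl in *. apply comb_gap_nonneg in H.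
  pose proof (spacing_pos N HN).
  assert (y = - 1) as -> by lra. unfold in_tooth; simpl. split_abs; lra.
Qed.

Lemma valley (j : nat) (y : R) :
  (j <= N)%nat -> 0 <= comb_gap N (spacing N * (5 * INR j), y) -> 0 <= y.
Proof.
  intros Hj H. apply comb_gap_nonneg in H. destruct H as (_ & _ & _ & H4 & H5).
  pose proof (spacing_pos N HN) as Hu.
  destruct (Nat.eq_dec j N) as [->|Hne].
  - rewrite spacing_total in H4 by exact HN. nra.
  - specialize (H5 j ltac:(lia)). rewrite Rminus_diag, Rabs_R0 in H5. nra.
Qed.

(** The segment would contain a point with the abscissa of the valley, at negative height as a
    convex combination of negative heights, hence in the spike. *)
Lemma segment_avoids_valley (j : nat) (b c : point) :
  (j <= N)%nat -> seg_in (fun z => 0 <= comb_gap N z) b c ->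
  snd b < 0 -> snd c < 0 ->
  (fst b - spacing N * (5 * INR j)) * (fst c - spacing N * (5 * INR j)) <= 0 -> False.
Proof.
  intros Hj Hs Hb Hc Hx. set (v := spacing N * (5 * INR j)) in *.
  assert (exists t, 0 <= t <= 1 /\ fst b + t * (fst c - fst b) = v) as (t & Ht & Et).
  { destruct (Req_dec (fst c) (fst b)) as [E|E].
    - exists 0. split; [lra|]. rewrite E in Hx. nra.
    - exists ((v - fst b) / (fst c - fst b)).
      assert ((v - fst b) / (fst c - fst b) * (fst c - fst b) = v - fst b) as Et by (field; lra).
      set (t := _ / _) in *. clearbody t. split; [|lra].
      destruct (Rtotal_order (fst b) (fst c)) as [Ho|[Ho|Ho]]; [|congruence|].
      + assert (fst b <= v <= fst c) by (split; apply Rnot_lt_le; intros Hn; nra).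
        split; apply Rnot_lt_le; intros Hn; nra.
      + assert (fst c <= v <= fst b) by (split; apply Rnot_lt_le; intros Hn; nra).
        split; apply Rnot_lt_le; intros Hn; nra. }
  assert (0 <= snd b + t * (snd c - snd b)); [|nra].
  apply (valley j _ Hj). fold v. rewrite <- Et.
  apply (Hs (lerp b c t)). now exists t.
Qed.

Lemma tooth_entered_from_above (j : nat) (b c : point) :
  (j < N)%nat -> seg_in (fun z => 0 <= comb_gap N z) b c ->
  in_tooth j c -> 0 <= snd b \/ in_tooth j b.
Proof.
  intros Hj Hs [Hc Hx]. destruct (Rle_or_lt 0 (snd b)) as [|Hb]; [now left|right].
  split; [exact Hb|]. split; apply Rnot_le_lt; intros H.
  - apply (segment_avoids_valley j b c); try assumption; [lia|]. nra.
  - apply (segment_avoids_valley (S j) b c); try assumption. rewrite S_INR. nra.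
Qed.

(** The second clause is the strengthening that makes the induction work: inside a tooth not yet
    counted, the current depth has been paid on top of one unit per counted tooth. A tooth is
    entered only from nonnegative height, where the first clause applies, and depth grows no faster
    than the travelled length. *)
Lemma teeth_cost (k : nat) (l : list nat) :
  NoDup l ->
  (forall j, In j l -> (j < N)%nat /\ exists k', (k' <= k)%nat /\ cone N j (w k')) ->
  INR (length l) <= trav k /\
  forall j, (j < N)%nat -> ~ In j l -> in_tooth j (w k) ->
    INR (length l) - snd (w k) <= trav k.
Proof.
  revert l. induction k as [|k IH]; intros l Hl Hvis.
  - destruct l as [|j l].
    + simpl. rewrite Htrav0. split; [lra|]. intros j _ _ [H _]. lra.
    + destruct (Hvis j) as (Hj & k' & Hk' & Hc); [now left|].
      replace k' with 0%nat in Hc by lia. destruct Hc as [Hc _]. lra.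
  - assert (0 <= comb_gap N (w (S k))) as Hin by (apply (Hseg k), on_seg_r).
    pose proof (dist_snd (w k) (w (S k))) as Hd. pose proof (dist_pos (w k) (w (S k))) as Hp.
    rewrite HtravS.
    assert (forall l', NoDup l' ->
      (forall j, In j l' -> (j < N)%nat /\ exists k', (k' <= k)%nat /\ cone N j (w k')) ->
      forall j, (j < N)%nat -> ~ In j l' -> in_tooth j (w (S k)) ->
      INR (length l') - snd (w (S k)) <= trav k + dist (w k) (w (S k))) as Hstep.
    { intros l' Hl' Hvis' j Hj Hnin Ht. destruct (IH l' Hl' Hvis') as [I1 I2].
      destruct (tooth_entered_from_above j (w k) (w (S k)) Hj (Hseg k) Ht) as [Ha|Ha].
      - split_abs; lra.
      - specialize (I2 j Hj Hnin Ha). split_abs; lra. }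
    destruct (classic (exists j, In j l /\ cone N j (w (S k)))) as [(j & Hjl & Hc)|Hno].
    + destruct (in_split j l Hjl) as (l1 & l2 & El).
      assert (NoDup (l1 ++ l2) /\ ~ In j (l1 ++ l2)) as [Hnd Hnin]
        by (rewrite El in Hl; split; [eapply NoDup_remove_1|eapply NoDup_remove_2]; exact Hl).
      destruct (cone_in_tooth j _ Hin Hc) as [Ey Ht].
      destruct (Hvis j Hjl) as [Hj _].
      (* The clause for uncounted teeth is used with [j] taken out of the list; at the bottom, the
         depth 1 pays for putting [j] back. *)
      assert (INR (length (l1 ++ l2)) - snd (w (S k)) <= trav k + dist (w k) (w (S k))) as Hcost.
      { apply (Hstep (l1 ++ l2) Hnd) with (j := j); [|exact Hj|exact Hnin|exact Ht].
        intros m Hm. assert (In m l) as Hml.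
        { rewrite El. rewrite in_app_iff in *. simpl. tauto. }
        destruct (Hvis m Hml) as (Hm1 & k' & Hk' & Hm2). split; [exact Hm1|].
        exists k'. split; [|exact Hm2].
        (* The new waypoint lies in tooth [j] alone, so every other tooth was reached earlier. *)
        destruct (Nat.eq_dec k' (S k)) as [->|]; [|lia]. exfalso.
        apply Hnin. destruct (cone_in_tooth m _ Hin Hm2) as [_ Ht'].
        now rewrite (in_tooth_unique j m _ Ht Ht'). }
      replace (length l) with (S (length (l1 ++ l2)))
        by (rewrite El, !length_app; simpl; lia).
      rewrite S_INR. split; [lra|].
      intros m _ Hm Htm. exfalso. apply Hm. now rewrite (in_tooth_unique m j _ Htm Ht).
    + assert (forall j, In j l ->
        (j < N)%nat /\ exists k', (k' <= k)%nat /\ cone N j (w k')) as Hold.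
      { intros j Hj. destruct (Hvis j Hj) as (H1 & k' & Hk' & H2). split; [exact H1|].
        exists k'. split; [|exact H2].
        destruct (Nat.eq_dec k' (S k)) as [->|]; [|lia]. exfalso. apply Hno. now exists j. }
      split.
      * destruct (IH l Hl Hold) as [I1 _]. lra.
      * now apply Hstep.
Qed.

(** The teeth are reached at different times; the latest of them is itself within budget, so it
    serves as a common time for all. *)
Lemma visited_teeth_bound (B : R) (l : list nat) :
  0 <= B -> NoDup l ->
  (forall j, In j l -> (j < N)%nat /\ exists k, trav k <= B /\ cone N j (w k)) ->
  INR (length l) <= B.
Proof.
  intros HB Hl H.
  assert (exists K, trav K <= B /\
    forall j, In j l -> (j < N)%nat /\ exists k, (k <= K)%nat /\ cone N j (w k)) as (K & HK & Hvis).
  { clear Hl. induction l as [|j l IH].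
    - exists 0%nat. rewrite Htrav0. split; [exact HB|]. intros j [].
    - destruct IH as (K & HK & HV); [intros; apply H; now right|].
      destruct (H j) as (Hj & k & Hk & Hc); [now left|].
      exists (max k K). split.
      + destruct (Nat.max_spec k K) as [[_ ->]|[_ ->]]; assumption.
      + intros m [<-|Hm].
        * split; [exact Hj|]. exists k. split; [lia|exact Hc].
        * destruct (HV m Hm) as (Hm1 & k' & Hk' & Hm2). split; [exact Hm1|].
          exists k'. split; [lia|exact Hm2]. }
  destruct (teeth_cost K l Hl Hvis). lra.
Qed.

End TeethAreCostly.

Lemma reference_waypoint_in (A N : nat) (alg : algorithm) (adv : list bool) (k : nat) :
  (8 < A)%nat -> (0 < N)%nat ->
  region (comb_config A N N) (waypoint alg adv (comb_config A N N) k) /\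
  seg_in (region (comb_config A N N)) (waypoint alg adv (comb_config A N N) k)
    (waypoint alg adv (comb_config A N N) (S k)).
Proof.
  intros HA HN. set (c := comb_config A N N).
  assert (8 <= INR A + 1) as HD by now apply depth_ge.
  assert (forall j, region c (waypoint alg adv c j) ->
    seg_in (region c) (waypoint alg adv c j) (waypoint alg adv c (S j))) as Hstep.
  { intros j Hj. unfold waypoint in *. cbn [run]. destruct (run alg adv c j) as [x h].
    pose proof (exec_seg_in c x (alg adv h)) as H.
    destruct (exec c x (alg adv h)) as [y f]. apply H; [| |exact Hj].
    - apply comb_region_closed; lra || lia.
    - intros z Hz. apply chain_shape in Hz; [|lia|lra|lia]. destruct Hz as (m & Hm & Hz).
      apply (chain_in_region N (INR A + 1) N) with (k := m); lra || lia || assumption. }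
  enough (region c (waypoint alg adv c k)) by auto.
  induction k as [|k IH].
  - left. apply room_in_comb; lra || lia.
  - apply (Hstep k IH). apply on_seg_r.
Qed.

(* A waypoint may overshoot the budget by one move, of length at most 4 in the reference comb. *)
Lemma unvisited_tooth_cost (A N i : nat) (alg : algorithm) (adv : list bool) (B : R) :
  (8 < A)%nat -> (i < N)%nat ->
  ~ (exists k, travelled alg adv (comb_config A N N) k <= B + 4 /\
       cone N i (waypoint alg adv (comb_config A N N) k)) ->
  cost_exceeds alg adv (comb_config A N i) B.
Proof.
  intros HA Hi Hun (k & t & Ht & HB & _ & Hsee).
  assert (0 < N)%nat as HN by lia.
  assert (9 <= INR A) as H9 by (apply le_INR in HA; simpl in HA; lra).
  set (c0 := comb_config A N N) in *. set (c := comb_config A N i) in *.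
  assert (forall j, fst (waypoint alg adv c0 j) <= 1 /\ 0 <= fst (waypoint alg adv c0 j) /\
            - 1 <= snd (waypoint alg adv c0 j) <= 1) as Hbox.
  { intros j. destruct (reference_waypoint_in A N alg adv j HA HN) as [H _].
    fold c0 in H. apply reference_region in H.
    destruct (waypoint alg adv c0 j) as [x y].
    pose proof (comb_abscissa N HN x y H). apply comb_gap_nonneg in H. simpl. lra. }
  (* The budget is known for the actual run and the missing visit for the simulated one. The
     induction alternates: agreement up to [j] transfers the budget to the simulation, which then
     keeps waypoint [S j] off the cone. *)
  assert (forall j, (j <= S k)%nat ->
            forall j', (j' <= j)%nat -> ~ cone N i (waypoint alg adv c0 j')) as Hclear.
  { induction j as [|j IH]; intros Hj j' Hj'.
    - replace j' with 0%nat by lia. intros [H _]. simpl in H. lra.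
    - destruct (Nat.eq_dec j' (S j)) as [->|]; [|apply IH; lia].
      intros Hcone. apply Hun. exists (S j). split; [|exact Hcone].
      assert (travelled alg adv c0 j <= B).
      { unfold c0. rewrite <- (travelled_agree A N i HA Hi alg adv j) by (apply IH; lia).
        fold c.
        assert (forall m, (m <= k)%nat -> travelled alg adv c m <= travelled alg adv c k) as Hm.
        { clear. intros m Hm. induction Hm as [|k Hm IHm]; [lra|]. cbn [travelled].
          pose proof (dist_pos (waypoint alg adv c k) (waypoint alg adv c (S k))). lra. }
        specialize (Hm j ltac:(lia)). simpl in HB.
        pose proof (dist_pos (waypoint alg adv c k) (waypoint alg adv c (S k))). nra. }
      cbn [travelled].
      pose proof (dist_le_abs (waypoint alg adv c0 j) (waypoint alg adv c0 (S j))).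
      pose proof (Hbox j). pose proof (Hbox (S j)). split_abs; lra. }
  assert (forall j, (j <= S k)%nat -> waypoint alg adv c j = waypoint alg adv c0 j) as E.
  { intros j Hj. unfold waypoint, c, c0. f_equal.
    apply run_agree; [exact HA|exact Hi|now apply Hclear]. }
  rewrite !E in Hsee by lia.
  pose proof (dist_snd (lerp (waypoint alg adv c0 k) (waypoint alg adv c0 (S k)) t)
    (treasure c)) as Hd.
  rewrite snd_lerp in Hd. simpl (snd (treasure c)) in Hd.
  pose proof (Hbox k). pose proof (Hbox (S k)).
  (* Along this move the agent is at depth at most 1, whereas the treasure is at depth [A], hence
     more than distance 1 away. *)
  assert (- 1 <= snd (waypoint alg adv c0 k) +
     t * (snd (waypoint alg adv c0 (S k)) - snd (waypoint alg adv c0 k))) by nra.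
  split_abs; lra.
Qed.

(** * Counting advice strings *)

Fixpoint words (n : nat) : list (list bool) :=
  match n with
  | O => nil :: nil
  | S m => nil :: map (cons true) (words m) ++ map (cons false) (words m)
  end.

Lemma words_complete (n : nat) (s : list bool) : (length s <= n)%nat -> In s (words n).
Proof.
  revert s. induction n as [|n IH]; intros [|[] s] H; simpl in *; try lia; auto;
    right; apply in_or_app; [left|right]; apply in_map, IH; lia.
Qed.

Lemma length_flat_map_le (X Y : Type) (f : X -> list Y) (M : nat) (l : list X) :
  (forall x, In x l -> (length (f x) <= M)%nat) ->
  (length (flat_map f l) <= length l * M)%nat.
Proof.
  induction l as [|x l IH]; intros H; simpl; [lia|]. rewrite length_app.
  pose proof (H x (or_introl eq_refl)). specialize (IH (fun y Hy => H y (or_intror Hy))). lia.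
Qed.

(** Otherwise all [N] indices would occur in the concatenation of the visited lists, whose length is
    at most [length ws * M]. The index found is missed under every [x] at once, so the advice may
    depend on it. *)
Lemma few_visited_pigeonhole (X : Type) (visits : X -> nat -> Prop) (ws : list X) (M N : nat) :
  (forall x l, NoDup l -> (forall i, In i l -> (i < N)%nat /\ visits x i) -> (length l <= M)%nat) ->
  (length ws * M < N)%nat ->
  exists i, (i < N)%nat /\ forall x, In x ws -> ~ visits x i.
Proof.
  intros Hfew HN. apply NNPP. intros Hn.
  set (vis := fun x => filter
    (fun i => bool_of (excluded_middle_informative (visits x i))) (seq 0 N)).
  assert (forall x i, In i (vis x) <-> (i < N)%nat /\ visits x i) as Hvis.
  { intros x i. unfold vis. rewrite filter_In, in_seq.
    destruct (excluded_middle_informative (visits x i)); simpl; split;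
      intros [H1 H2]; split;
        try lia; try assumption; try reflexivity; discriminate || contradiction. }
  assert (length (seq 0 N) <= length (flat_map vis ws))%nat as Hle.
  { apply NoDup_incl_length; [apply seq_NoDup|]. intros i Hi. apply in_seq in Hi.
    apply in_flat_map. apply NNPP. intros Hm. apply Hn. exists i. split; [lia|].
    intros x Hx Hv. apply Hm. exists x. split; [exact Hx|]. apply Hvis. split; [lia|exact Hv]. }
  rewrite length_seq in Hle.
  pose proof (length_flat_map_le X nat vis M ws) as Hub.
  assert (length (flat_map vis ws) <= length ws * M)%nat; [|lia].
  apply Hub. intros x _. apply (Hfew x).
  - apply NoDup_filter, seq_NoDup.
  - intros i. apply Hvis.
Qed.

Lemma cost_exceeds_mono (alg : algorithm) (adv : list bool) (c : config) (B B' : R) :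
  B' <= B -> cost_exceeds alg adv c B -> cost_exceeds alg adv c B'.
Proof.
  intros H Hc (k & t & Ht & HB & Hs). apply Hc. exists k, t.
  split; [exact Ht|]. split; [lra|exact Hs].
Qed.

Theorem theorem3p1 :
  exists Cls : nat -> config -> Prop,
    (forall (A : nat), (8 < A)%nat -> forall c, Cls A c ->
       is_config c /\ ~ convex (region c) /\
       INR A / 2 < geodist c < 5 * INR A / 2 /\
       accessibility c = 1) /\
    (forall C : R, 0 < C -> exists A0 : nat,
       forall (A : nat), (8 < A)%nat -> (A0 <= A)%nat ->
       forall (alg : algorithm) (adv : config -> list bool),
         (forall c, Cls A c -> INR (length (adv c)) <= INR A / 2) ->
         exists c, Cls A c /\ cost_exceeds alg (adv c) c (C * geodist c)).
Proof.
  exists comb_class. split.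
  { intros A HA c Hc. now apply comb_class_spec. }
  intros C HC. exists 0%nat. intros A HA _ alg adv Hadv.
  (* [A + 2] bounds the geodesic distance in every comb of the class, so [B] is a budget independent
     of [N] and of the tooth. *)
  set (B := C * (INR A + 2)).
  assert (0 <= INR A) as HA0 by apply pos_INR.
  assert (0 <= B) as HB by (unfold B; nra).
  (* [M] bounds the number of teeth reached under one advice string; the 4 allows for the last move,
     which may exceed the budget. *)
  destruct (INR_unbounded (B + 4)) as [M HM].
  set (N := S (length (words A) * M)).
  destruct (few_visited_pigeonhole (list bool)
    (fun s i => exists k, travelled alg s (comb_config A N N) k <= B + 4 /\
       cone N i (waypoint alg s (comb_config A N N) k)) (words A) M N) as (i & Hi & Hun).
  - intros s l Hl Hvis. apply INR_le.
    apply Rle_trans with (B + 4); [|lra].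
    apply (visited_teeth_bound N (waypoint alg s (comb_config A N N))
             (travelled alg s (comb_config A N N))); try assumption; try reflexivity; try lra.
    + unfold N; lia.
    + intros k z Hz. apply (reference_region A N).
      now apply (reference_waypoint_in A N alg s k HA ltac:(unfold N; lia)).
    + simpl. lra.
  - unfold N; lia.
  - exists (comb_config A N i). assert (comb_class A (comb_config A N i)) as Hc by now exists N, i.
    split; [exact Hc|].
    apply cost_exceeds_mono with (B := B).
    + pose proof (comb_geodist A N i HA Hi). unfold B. nra.
    + apply unvisited_tooth_cost; [exact HA|exact Hi|]. apply Hun, words_complete.
      (* [words A] lists all strings of length at most [A], among them those of length at most
         [A / 2]. *)
      apply INR_le. specialize (Hadv _ Hc). lra.
Qed.
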